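(* Let $d\ge 1$ be fixed and let $m_n\to\infty$ as $n\to\infty$. Let $X_n\in\mathbb{R}^{n\times d}$, $y_n\in\mathbb{R}^n$ be deterministic, $\lambda_n>0$, and let $H_n,g_n,A_n,\beta_n$, the sketch rows $s_{n,i}$, compressed rows $(z_{n,i},u_{n,i})$, influence vectors $\psi_{n,i}$, sketched estimator $\widehat\beta_{n,m_n}$, bootstrap estimator $\widehat\beta^*_{n,m_n,b}$ and linearized bootstrap change $\widetilde\Delta^*_{n,m_n,b}$ be as defined in the context. Assume: (i) as $n\to\infty$, $\lambda_n\to\lambda_\infty\ge 0$, $H_n\to H$, $g_n\to g$ (finite limits), and there is $c_0>0$ with $\lambda_{\min}(H_n+\lambda_n I_d)\ge c_0$ for all sufficiently large $n$; (ii) for every $n$, $s_{n,1},\dots,s_{n,m_n}$ are i.i.d. with $\mathbb{E}(s_{n,1}s_{n,1}^\top)=I_n$; $$\sup_n \mathbb{E}\Big[\|z_{n,1}z_{n,1}^\top-H_n\|_{\mathrm F}^4+\|z_{n,1}u_{n,1}-g_n\|_2^4\Big]<\infty;$$ and there is a finite matrix $\Omega\in\mathbb{R}^{d\times d}$ such that $\Omega_n:=\mathbb{E}(\psi_{n,1}\psi_{n,1}^\top)\to\Omega$. Then for the first bootstrap replicate (and hence for any fixed replicate index) and every $\varepsilon>0$, $$\mathbb{P}^*\Big\{\sqrt{m_n}\,\big\|(\widehat\beta^*_{n,m_n,1}-\widehat\beta_{n,m_n})-\widetilde\Delta^*_{n,m_n,1}\big\|_2>\varepsilon\Big\}\longrightarrow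 0$$ in probability with respect to the law of the sketch. That is, for any fixed replicate index, the two bootstrap perturbations differ by $o_p^*(m_n^{-1/2})$ in probability with respect to the law of the sketch.
   Context: All limits are along one sequence $n\to\infty$ with $d$ fixed. Define $H_n:=\frac1n X_n^\top X_n$, $g_n:=\frac1n X_n^\top y_n$, $A_n:=(H_n+\lambda_n I_d)^{-1}$, $\beta_n:=A_ng_n$ (the minimizer over $\beta\in\mathbb{R}^d$ of $\frac1n\|X_n\beta-y_n\|_2^2+\lambda_n\|\beta\|_2^2$). For random sketch rows $s_{n,1},\dots,s_{n,m}\in\mathbb{R}^n$ define $z_{n,i}:=n^{-1/2}X_n^\top s_{n,i}\in\mathbb{R}^d$, $u_{n,i}:=n^{-1/2}y_n^\top s_{n,i}\in\mathbb{R}$, $\widehat H_{n,m}:=\frac1m\sum_{i=1}^m z_{n,i}z_{n,i}^\top$, $\widehat g_{n,m}:=\frac1m\sum_{i=1}^m z_{n,i}u_{n,i}$, $\widehat A_{n,m}:=(\widehat H_{n,m}+\lambda_nI_d)^{-1}$, and the sketched estimator $\widehat\beta_{n,m}:=\widehat A_{n,m}\widehat g_{n,m}$. The influence vectors are $\psi_{n,i}:=A_n\{z_{n,i}(u_{n,i}-z_{n,i}^\top\beta_n)-\lambda_n\beta_n\}$, which have mean zero when the rows are isotropic. Bootstrap: conditionally on the sketch, draw independent weight vectors $w_b=(w_{b,1},\dots,w_{b,m})\sim\mathrm{Multinomial}(m;\frac1m,\dots,\frac1m)$, $b=1,2,\dots$, and set $\widehat H^*_{n,m,b}:=\frac1m\sum_i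 w_{b,i}z_{n,i}z_{n,i}^\top$, $\widehat g^*_{n,m,b}:=\frac1m\sum_i w_{b,i}z_{n,i}u_{n,i}$, $\widehat\beta^*_{n,m,b}:=(\widehat H^*_{n,m,b}+\lambda_nI_d)^{-1}\widehat g^*_{n,m,b}$ (refitting). The linearized bootstrap change is $$\widetilde\Delta^*_{n,m,b}:=\widehat A_{n,m}\big\{(\widehat g^*_{n,m,b}-\widehat g_{n,m})-(\widehat H^*_{n,m,b}-\widehat H_{n,m})\widehat\beta_{n,m}\big\}=\widehat A_{n,m}\frac1m\sum_{i=1}^m(w_{b,i}-1)z_{n,i}(u_{n,i}-z_{n,i}^\top\widehat\beta_{n,m}).$$ $\mathbb{P}^*$ denotes conditional probability given $\sigma(s_{n,1},\dots,s_{n,m_n})$. $Y_n^*=o_p^*(a_n)$ in probability with respect to the law of the sketch means: for every $\varepsilon>0$, $\mathbb{P}^*(\|Y_n^*\|>\varepsilon a_n)\to0$ in probability. $\|\cdot\|_{\mathrm F}$ is the Frobenius norm and $\lambda_{\min}$ the smallest eigenvalue. *)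

(* Defs.v *)
From HB Require Import structures.
From mathcomp Require Import all_boot all_order all_algebra.
From mathcomp Require Import all_classical all_reals all_analysis.
Set Implicit Arguments.
Unset Strict Implicit.
Unset Printing Implicit Defensive.
Import Order.TTheory GRing.Theory Num.Theory.
Import numFieldNormedType.Exports.

Local Open Scope classical_set_scope.
Local Open Scope ring_scope.

Section Norms.
Context {R : realType}.

(* The library's `|M| on matrices is the entrywise maximum. *)
Definition frob_norm p q (M : 'M[R]_(p, q)) : R :=
  Num.sqrt (\sum_i \sum_j M i j ^+ 2).

Definition norm2 p (v : 'cV[R]_p) : R := Num.sqrt (\sum_i v i 0 ^+ 2).

(* For a symmetric matrix of positive size the set of eigenvalues is finite and
   nonempty, so that this infimum is the smallest eigenvalue. *)
Definition lambda_min p (M : 'M[R]_p) : R := inf [set a | eigenvalue M a].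

End Norms.

Section Ridge.
Context {R : realType} {n d : nat}.
Implicit Types (X : 'M[R]_(n, d)) (y : 'cV[R]_n) (lam : R).

Definition gram X : 'M[R]_d := n%:R^-1 *: (X^T *m X).
Definition cross X y : 'cV[R]_d := n%:R^-1 *: (X^T *m y).

Definition resolvent (H : 'M[R]_d) lam : 'M[R]_d := invmx (H + lam%:M).

Definition ridge X y lam : 'cV[R]_d := resolvent (gram X) lam *m cross X y.

Definition col_of_tuple (s : n.-tuple R) : 'cV[R]_n := \col_j tnth s j.

Definition zrow X (s : n.-tuple R) : 'cV[R]_d :=
  (Num.sqrt n%:R)^-1 *: (X^T *m col_of_tuple s).
Definition uentry y (s : n.-tuple R) : R :=
  (Num.sqrt n%:R)^-1 * (y^T *m col_of_tuple s) 0 0.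

Definition influence X y lam (s : n.-tuple R) : 'cV[R]_d :=
  resolvent (gram X) lam *m
    ((uentry y s - ((zrow X s)^T *m ridge X y lam) 0 0) *: zrow X s
     - lam *: ridge X y lam).

End Ridge.

Section SketchBootstrap.
Context {R : realType} {d m : nat}.
Variables (z : 'I_m -> 'cV[R]_d) (u : 'I_m -> R) (lam : R).
Implicit Type w : 'I_m -> nat.

Definition Hhat : 'M[R]_d := m%:R^-1 *: \sum_i z i *m (z i)^T.
Definition ghat : 'cV[R]_d := m%:R^-1 *: \sum_i u i *: z i.
Definition betahat : 'cV[R]_d := resolvent Hhat lam *m ghat.

Definition Hstar w : 'M[R]_d := m%:R^-1 *: \sum_i (w i)%:R *: (z i *m (z i)^T).
Definition gstar w : 'cV[R]_d := m%:R^-1 *: \sum_i (w i)%:R *: (u i *: z i).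
Definition betastar w : 'cV[R]_d := resolvent (Hstar w) lam *m gstar w.

Definition lin_change w : 'cV[R]_d :=
  resolvent Hhat lam *m ((gstar w - ghat) - (Hstar w - Hhat) *m betahat).

End SketchBootstrap.

Section Probability.
Context {R : realType} {disp : measure_display} {T : measurableType disp}.
Variable P : probability T R.

(* The entries are kept in \bar R, so that no finiteness is presupposed. *)
Definition expect_mx p q (M : T -> 'M[R]_(p, q)) : 'M[\bar R]_(p, q) :=
  \matrix_(i, j) 'E_P[fun x => M x i j]%E.

Definition mutually_independent (I : finType) dE (E : measurableType dE)
    (s : I -> {RV P >-> E}) : Prop :=
  forall (J : {set I}) (B : I -> set E), (forall i, measurable (B i)) ->
    (P (\bigcap_(i in [set` J]) s i @^-1` B i) =
     \prod_(i in J) P (s i @^-1` B i))%E.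

(* Laws are compared on measurable sets only: a measure of the library is a
   function on all sets, unconstrained outside the sigma-algebra. *)
Definition identically_distributed (I : Type) dE (E : measurableType dE)
    (s : I -> {RV P >-> E}) : Prop :=
  forall i j (B : set E), measurable B ->
    distribution P (s i) B = distribution P (s j) B.

(* q is a version of the conditional probability of A given G. *)
Definition is_cond_prob (G : set (set T)) (A : set T) (q : T -> R) : Prop :=
  [/\ forall B : set R, measurable B -> G (q @^-1` B),
      P.-integrable setT (EFin \o q) &
      forall B, G B -> (\int[P]_(x in B) (q x)%:E)%E = P (A `&` B)].

Definition multinomial_pmf (m N : nat) (p : 'I_m -> R) (k : 'I_m -> nat) : R :=
  if (\sum_i k i == N)%N then
    N`!%:R / (\prod_i (k i)`!)%:R * \prod_i p i ^+ k i
  else 0.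

(* Conditionally on G, the vectors (w b i)_i, b = 0, 1, 2, ..., are independent
   with law Multinomial(m; 1/m, ..., 1/m): the conditional joint mass function of
   the first N of them is a product of multinomial mass functions. *)
Definition multinomial_weights (G : set (set T)) (m : nat)
    (w : nat -> 'I_m -> {RV P >-> nat}) : Prop :=
  forall (N : nat) (k : nat -> 'I_m -> nat),
    is_cond_prob G
      [set x | forall b i, (b < N)%N -> w b i x = k b i]
      (cst (\prod_(b < N) multinomial_pmf m (fun=> m%:R^-1) (k b))).

End Probability.

Section TriangularArray.
Context {R : realType} (disp : nat -> measure_display)
  (T : forall n, measurableType (disp n)) (P : forall n, probability (T n) R).

Definition cvg0_in_probability (q : forall n, T n -> R) : Prop :=
  forall delta : R, 0 < delta ->
    P n [set x | delta < `|q n x|] @[n --> \oo] --> 0%E.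

(* The sequence of conditional probabilities of A n given G n tends to 0 in
   probability, whichever versions are chosen. *)
Definition cond_prob_cvg0 (G : forall n, set (set (T n)))
    (A : forall n, set (T n)) : Prop :=
  forall q : forall n, T n -> R,
    (forall n, is_cond_prob (P n) (G n) (A n) (q n)) -> cvg0_in_probability q.

End TriangularArray.

(* Main.v *)
(* Since a version q of the conditional probability of an event A satisfies
   E q = P A, Markov's inequality reduces the claim to the unconditional
   P A_n -> 0. The two bootstrap changes are A* r and A^ r for one residual r, so
   their difference is - A* (H* - H^) A^ r, a product of two O(m^(-1/2)) factors.
   The resolvents stay bounded because the smallest eigenvalue bounds the
   quadratic form of H_n + lam_n from below and H^, H* are Frobenius-close to H_n.
   It remains to bound the second moments of H^ - H_n, g^ - g_n (independence and
   isotropy of the rows) and of H* - H^, g* - g^: averaging over the multinomial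
   weights turns the square of sum_i (w_i - 1) a_i into sum_i (a_i - mean a)^2. *)
Require Import Defs.
From HB Require Import structures.
From mathcomp Require Import all_boot all_order all_algebra.
From mathcomp Require Import all_classical all_reals all_analysis.
From mathcomp Require Import measurable_realfun ring lra.
Set Implicit Arguments.
Unset Strict Implicit.
Unset Printing Implicit Defensive.
Import Order.TTheory GRing.Theory Num.Theory.
Import numFieldNormedType.Exports.

Local Open Scope classical_set_scope.
Local Open Scope ring_scope.

(** * Frobenius norm and coercive matrices *)

(** The weights are given only by their conditional mass functions, so they are frozen rather than
    averaged directly: for each count vector k, the event that [boot_dev] with weights k reaches
    [eta] depends on the sketch alone, and P A is at most the sum over k of pmf(k) times its
    probability. Markov's inequality for each k, and a finite exchange of sum and integral, put the
    multinomial average inside the sketch integral. All deviations enter one scalar because the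
    deterministic half needs them small together: below [eta] both resolvents are bounded and the
    scaled error is at most eps. The weight sqrt m fits the product structure: with h = |H* - H^|, l
    = |g* - g^| and B a bound for beta^, sqrt m h (l + B h) <= (1 + B) sqrt m (h^2 + l^2), whose
    mean is of order m^(-1/2). This is the rate of the final bound. *)

Section Frobenius.
Context {R : realType}.

(** Lagrange's identity: the nonnegative double sum of [(a i * b j - a j * b i) ^+ 2] is twice the
    difference of the two sides. *)
Lemma cauchy_schwarz_sum (I : finType) (a b : I -> R) :
  (\sum_i a i * b i) ^+ 2 <= (\sum_i a i ^+ 2) * (\sum_i b i ^+ 2).
Proof.
have : 0 <= \sum_i \sum_j (a i * b j - a j * b i) ^+ 2.
  by do 2![apply: sumr_ge0 => ? _]; exact: sqr_ge0.
rewrite (_ : \sum_i _ = 2 * ((\sum_i a i ^+ 2) * (\sum_i b i ^+ 2))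
                        - 2 * (\sum_i a i * b i) ^+ 2); first by lra.
transitivity (\sum_i \sum_j ((a i ^+ 2 * b j ^+ 2 + b i ^+ 2 * a j ^+ 2)
                - 2 * ((a i * b i) * (a j * b j)))).
  by apply: eq_bigr => i _; apply: eq_bigr => j _; ring.
under eq_bigr do rewrite sumrB big_split/= -!mulr_sumr.
rewrite sumrB big_split/= -!mulr_suml -mulr_sumr -mulr_suml.
by ring.
Qed.

Lemma frob_norm_ge0 p q (M : 'M[R]_(p, q)) : 0 <= frob_norm M.
Proof. exact: sqrtr_ge0. Qed.

Lemma sqr_frob_norm p q (M : 'M[R]_(p, q)) :
  frob_norm M ^+ 2 = \sum_i \sum_j M i j ^+ 2.
Proof.
by rewrite sqr_sqrtr//; do 2![apply: sumr_ge0 => ? _]; exact: sqr_ge0.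
Qed.

Lemma frob_norm_leP p q (M : 'M[R]_(p, q)) (e : R) : 0 <= e ->
  (frob_norm M <= e) = (\sum_i \sum_j M i j ^+ 2 <= e ^+ 2).
Proof.
move=> e0; rewrite -sqr_frob_norm ler_pXn2r// ?nnegrE//; exact: frob_norm_ge0.
Qed.

Lemma norm2E p (v : 'cV[R]_p) : norm2 v = frob_norm v.
Proof.
by rewrite /norm2 /frob_norm; congr Num.sqrt; apply: eq_bigr => i _;
  rewrite big_ord1.
Qed.

Lemma sqr_entry_le_frob p q (M : 'M[R]_(p, q)) i j :
  M i j ^+ 2 <= frob_norm M ^+ 2.
Proof.
rewrite sqr_frob_norm (bigD1 i)//= (bigD1 j)//= -addrA lerDl addr_ge0//.
  by apply: sumr_ge0 => ? _; exact: sqr_ge0.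
by do 2![apply: sumr_ge0 => ? _]; exact: sqr_ge0.
Qed.

Lemma entry_le_frob p q (M : 'M[R]_(p, q)) i j : `|M i j| <= frob_norm M.
Proof.
by rewrite -(@ler_pXn2r _ 2)// ?nnegrE ?frob_norm_ge0// real_normK
  ?num_real//; exact: sqr_entry_le_frob.
Qed.

Lemma frob_norm_eq0 p q (M : 'M[R]_(p, q)) : (frob_norm M == 0) = (M == 0).
Proof.
apply/eqP/eqP => [M0|->].
  apply/matrixP => i j; rewrite mxE; apply/eqP; rewrite -normr_le0 -M0.
  exact: entry_le_frob.
apply/eqP; rewrite -sqrf_eq0 sqr_frob_norm big1// => i _.
by rewrite big1// => j _; rewrite mxE expr0n.
Qed.

Lemma frob_norm0 p q : frob_norm (0 : 'M[R]_(p, q)) = 0.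
Proof. by apply/eqP; rewrite frob_norm_eq0. Qed.

Lemma sqr_frob_norm_gt0 p q (M : 'M[R]_(p, q)) :
  M != 0 -> 0 < frob_norm M ^+ 2.
Proof.
by move=> M0; rewrite lt_neqAle sqr_ge0 andbT eq_sym sqrf_eq0 frob_norm_eq0.
Qed.

Lemma frob_normN p q (M : 'M[R]_(p, q)) : frob_norm (- M) = frob_norm M.
Proof.
congr Num.sqrt; apply: eq_bigr => i _; apply: eq_bigr => j _.
by rewrite mxE sqrrN.
Qed.

Lemma frob_norm_tr p q (M : 'M[R]_(p, q)) : frob_norm M^T = frob_norm M.
Proof.
congr Num.sqrt; rewrite exchange_big/=.
by apply: eq_bigr => i _; apply: eq_bigr => j _; rewrite mxE.
Qed.

Lemma frob_norm_mul p q r (A : 'M[R]_(p, q)) (B : 'M[R]_(q, r)) :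
  frob_norm (A *m B) <= frob_norm A * frob_norm B.
Proof.
rewrite frob_norm_leP ?mulr_ge0 ?frob_norm_ge0// exprMn !sqr_frob_norm.
rewrite [X in _ * X]exchange_big/= mulr_suml.
apply: ler_sum => i _; rewrite mulr_sumr; apply: ler_sum => k _.
by rewrite mxE; exact: cauchy_schwarz_sum.
Qed.

Lemma frob_normD p q (A B : 'M[R]_(p, q)) :
  frob_norm (A + B) <= frob_norm A + frob_norm B.
Proof.
rewrite frob_norm_leP ?addr_ge0 ?frob_norm_ge0//.
rewrite sqrrD !sqr_frob_norm.
set s := \sum_i \sum_j A i j * B i j.
rewrite (_ : \sum_i _ = \sum_i \sum_j A i j ^+ 2 + s *+ 2
                        + \sum_i \sum_j B i j ^+ 2); last first.
  rewrite /s -sumrMnl -!big_split/=; apply: eq_bigr => i _.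
  rewrite -sumrMnl -!big_split/=; apply: eq_bigr => j _.
  by rewrite mxE sqrrD.
rewrite lerD2r lerD2l lerMn2r/=.
apply: le_trans (ler_norm _) _.
rewrite -(@ler_pXn2r _ 2)// ?nnegrE ?mulr_ge0 ?frob_norm_ge0//.
rewrite real_normK ?num_real// exprMn !sqr_frob_norm /s !pair_big/=.
exact: (cauchy_schwarz_sum (fun x => A x.1 x.2) (fun x => B x.1 x.2)).
Qed.

Lemma frob_normB p q (A B : 'M[R]_(p, q)) :
  frob_norm (A - B) <= frob_norm A + frob_norm B.
Proof. by rewrite -(frob_normN B) frob_normD. Qed.

Lemma frob_norm_col_dot p (v : 'cV[R]_p) :
  (v^T *m v) 0 0 = frob_norm v ^+ 2.
Proof.
rewrite mxE sqr_frob_norm; apply: eq_bigr => i _.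
by rewrite big_ord1 mxE expr2.
Qed.

End Frobenius.

Section Coercive.
Context {R : realType}.

(** For symmetric N this bounds the spectrum below by c, in a form that survives perturbation
    without mention of eigenvalues. No sign is imposed on c: [coercive N 0] is positive
    semidefiniteness. *)
Definition coercive d (N : 'M[R]_d) (c : R) :=
  forall v : 'cV[R]_d, c * frob_norm v ^+ 2 <= (v^T *m N *m v) 0 0.

Lemma quad_form_le d (N : 'M[R]_d) (v : 'cV[R]_d) :
  `|(v^T *m N *m v) 0 0| <= frob_norm N * frob_norm v ^+ 2.
Proof.
apply: le_trans (entry_le_frob _ _ _) _.
apply: le_trans (frob_norm_mul _ _) _.
rewrite expr2 mulrA ler_wpM2r ?frob_norm_ge0//.
by apply: le_trans (frob_norm_mul _ _) _; rewrite frob_norm_tr mulrC.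
Qed.

Lemma quad_formD d (N N' : 'M[R]_d) (v : 'cV[R]_d) :
  (v^T *m (N + N') *m v) 0 0 = (v^T *m N *m v) 0 0 + (v^T *m N' *m v) 0 0.
Proof. by rewrite mulmxDr mulmxDl mxE. Qed.

Lemma coerciveW d (N : 'M[R]_d) c c' : c' <= c -> coercive N c -> coercive N c'.
Proof.
by move=> cc Nc v; apply: le_trans (Nc v); rewrite ler_wpM2r ?sqr_ge0.
Qed.

(** As in Weyl's inequality, a perturbation of Frobenius norm e moves the quadratic form by at most
    e |v|^2. *)
Lemma coercive_perturb d (N N' : 'M[R]_d) c e :
  coercive N c -> frob_norm (N' - N) <= e -> coercive N' (c - e).
Proof.
move=> Nc Ne v.
have := ler_wpM2r (sqr_ge0 (frob_norm v)) Ne.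
have := Nc v; have := quad_form_le (N' - N) v.
have -> : (v^T *m N' *m v) 0 0
    = (v^T *m N *m v) 0 0 + (v^T *m (N' - N) *m v) 0 0.
  by rewrite -quad_formD addrC subrK.
rewrite ler_norml => /andP[+ _].
set a := (_ *m N *m v) 0 0; set b := (_ *m (N' - N) *m v) 0 0.
by move=> ? ? ?; lra.
Qed.

Lemma coercive_bound d (N : 'M[R]_d) c (v : 'cV[R]_d) : 0 < c ->
  coercive N c -> c * frob_norm v <= frob_norm (N *m v).
Proof.
move=> c0 Nc; have [v0|v0] := eqVneq (frob_norm v) 0.
  by rewrite v0 mulr0 frob_norm_ge0.
have vp : 0 < frob_norm v by rewrite lt_neqAle eq_sym v0 frob_norm_ge0.
rewrite -(ler_pM2r vp) -mulrA -expr2.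
apply: le_trans (Nc v) (le_trans (ler_norm _) (le_trans (entry_le_frob _ _ _) _)).
rewrite -mulmxA; apply: le_trans (frob_norm_mul _ _) _.
by rewrite frob_norm_tr mulrC.
Qed.

(** [kermx] is a left kernel, so it is applied to the transpose of N: its rows, transposed, are
    column vectors killed by N. *)
Lemma mulmx_inj_unit d (N : 'M[R]_d) :
  (forall v : 'cV[R]_d, N *m v = 0 -> v = 0) -> N \in unitmx.
Proof.
move=> Ninj; rewrite -unitmx_tr -row_free_unit -kermx_eq0; apply/eqP.
apply/row_matrixP => i; rewrite row0; apply: trmx_inj; rewrite trmx0.
apply: Ninj; apply: trmx_inj; rewrite trmx_mul trmxK trmx0.
by rewrite -row_mul mulmx_ker row0.
Qed.

Lemma coercive_unitmx d (N : 'M[R]_d) c : 0 < c -> coercive N c ->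
  N \in unitmx.
Proof.
move=> c0 Nc; apply: mulmx_inj_unit => v Nv0; apply/eqP.
rewrite -frob_norm_eq0 eq_le frob_norm_ge0 andbT -(ler_pM2l c0) mulr0.
apply: le_trans (coercive_bound v c0 Nc) _.
by rewrite Nv0 frob_norm0.
Qed.

(** Stated on vectors because 1/c bounds the operator norm of the inverse; its Frobenius norm would
    cost a factor depending on d. *)
Lemma coercive_invmx d (N : 'M[R]_d) c (v : 'cV[R]_d) : 0 < c ->
  coercive N c -> frob_norm (invmx N *m v) <= c^-1 * frob_norm v.
Proof.
move=> c0 Nc; rewrite ler_pdivlMl//; apply: le_trans (coercive_bound _ c0 Nc) _.
by rewrite mulmxA mulmxV ?mul1mx//; exact: coercive_unitmx Nc.
Qed.

Lemma coercive_scalar_add d (N : 'M[R]_d) c t :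
  coercive N c -> coercive (N + t%:M) (c + t).
Proof.
move=> Nc v; rewrite quad_formD mulrDl lerD//.
by rewrite mul_mx_scalar -scalemxAl mxE frob_norm_col_dot.
Qed.

(* With w = N^-1 v and F a bound for N^-1, expand
   0 <= (w - (F+1) v)^T N (w - (F+1) v). *)
Lemma psd_unit_coercive d (N : 'M[R]_d) : N^T = N -> coercive N 0 ->
  N \in unitmx -> exists2 c, 0 < c & coercive N c.
Proof.
move=> Nsym N0 Nu; set F := frob_norm (invmx N).
have F0 : 0 <= F by exact: frob_norm_ge0.
exists (F + 1)^-1; first by rewrite invr_gt0 ltr_wpDl.
move=> v; rewrite ler_pdivrMl ?ltr_wpDl//.
set w := invmx N *m v.
have Nw : N *m w = v by rewrite mulmxA mulmxV// mul1mx.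
have wN : w^T *m N = v^T by rewrite -[in RHS]Nw [RHS]trmx_mul Nsym.
have qw : (w^T *m N *m w) 0 0 <= F * frob_norm v ^+ 2.
  rewrite wN mulmxA; apply: le_trans (ler_norm _) _; exact: quad_form_le.
have vNw : (v^T *m N *m w) 0 0 = frob_norm v ^+ 2.
  by rewrite -mulmxA Nw frob_norm_col_dot.
have wNv : (w^T *m N *m v) 0 0 = frob_norm v ^+ 2.
  by rewrite wN frob_norm_col_dot.
have := N0 (w - (F + 1) *: v); rewrite mul0r.
have -> : ((w - (F + 1) *: v)^T *m N *m (w - (F + 1) *: v)) 0 0 =
    (w^T *m N *m w) 0 0 - (F + 1) * (w^T *m N *m v) 0 0
    - (F + 1) * (v^T *m N *m w) 0 0 + (F + 1) ^+ 2 * (v^T *m N *m v) 0 0.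
  have -> : (w - (F + 1) *: v)^T = w^T - (F + 1) *: v^T.
    by apply/matrixP => i j; rewrite !mxE.
  rewrite !(mulmxBl, mulmxBr) -?scalemxAl -?scalemxAr -?scalemxAl.
  rewrite -?scalemxAr scalerA.
  move: (w^T *m N *m w) (v^T *m N *m w) (w^T *m N *m v) (v^T *m N *m v).
  by move=> q1 q2 q3 q4; rewrite !mxE; ring.
rewrite vNw wNv => h.
(* With a = |v|^2 and b = v^T N v, the expansion, whose first term is at most F a, gives (F+1)^2 b
   >= (F+2) a, more than the (F+1) a required. *)
rewrite -(ler_pM2l (_ : 0 < F + 1)) ?ltr_wpDl//.
set a := frob_norm v ^+ 2 in qw h *; set b := (v^T *m N *m v) 0 0 in h *.
have : 0 <= a by exact: sqr_ge0.
by nra.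
Qed.

(* The largest t0 such that N - t0 is positive semidefinite is an eigenvalue:
   otherwise psd_unit_coercive would apply to N - t0 and improve t0. *)
Lemma lambda_min_coercive d (N : 'M[R]_d) c : N^T = N -> coercive N 0 ->
  c <= lambda_min N -> coercive N c.
Proof.
case: d N => [|d] N Nsym N0 cN.
  move=> v; rewrite (_ : v = 0) ?mulmx0 ?mxE; last by apply/matrixP => -[].
  by rewrite frob_norm0 expr0n mulr0.
pose S := [set t | coercive N t].
have Sbound t (v : 'cV[R]_d.+1) : v != 0 -> S t ->
    t <= (v^T *m N *m v) 0 0 / frob_norm v ^+ 2.
  by move=> v0 St; rewrite ler_pdivlMr ?sqr_frob_norm_gt0//; exact: St.
(* Positive size enters here: a nonzero vector exists, and its Rayleigh quotient bounds S above. *)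
have one0 : const_mx 1 != 0 :> 'cV[R]_d.+1.
  by apply/eqP => /matrixP/(_ 0 0)/eqP; rewrite !mxE oner_eq0.
have supS : has_sup S.
  split; first by exists 0.
  by eexists => t; exact: Sbound one0.
set t0 := sup S.
(* Every Rayleigh quotient is an upper bound of S, hence at least [t0]: coercivity passes to the
   supremum. *)
have Nt0 : coercive N t0.
  move=> v; have [->|v0] := eqVneq v 0.
    by rewrite mulmx0 mxE frob_norm0 expr0n mulr0.
  rewrite -ler_pdivlMr ?sqr_frob_norm_gt0//.
  by apply: ge_sup; [exact: supS.1|move=> t; exact: Sbound].
have Nt0u : N - t0%:M \notin unitmx.
  apply/negP => Nu.
  have [|||e e_gt0 Ne] := @psd_unit_coercive _ (N - t0%:M).
  - by rewrite [LHS]raddfB/= tr_scalar_mx Nsym.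
  - have := coercive_scalar_add (- t0) Nt0.
    by rewrite subrr raddfN.
  - by [].
  - have : S (e + t0).
      by have := coercive_scalar_add t0 Ne; rewrite subrK.
    by move/(ub_le_sup supS.2); rewrite -/t0 gerDr leNgt e_gt0.
have eig : eigenvalue N t0.
  by rewrite /eigenvalue /eigenspace kermx_eq0 row_free_unit.
apply: (coerciveW _ Nt0); apply: le_trans cN _.
(* The infimum lies below its member [t0] once the eigenvalues are bounded below; testing [Nt0] on
   an eigenvector shows that [t0] is itself such a bound. *)
apply: ge_inf => //; exists t0 => a /= /eigenvalueP[v vN v0].
have vvE : (v *m v^T) 0 0 = frob_norm v^T ^+ 2.
  by rewrite -frob_norm_col_dot trmxK.
have := Nt0 v^T; rewrite trmxK vN -scalemxAl [leRHS]mxE vvE.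
by rewrite ler_pM2r// sqr_frob_norm_gt0// trmx_eq0.
Qed.

End Coercive.

(** * Deterministic comparison of refitting and linearization *)

Section Refit.
Context {R : realType}.

Lemma invmx_sub d (A B : 'M[R]_d) : A \in unitmx -> B \in unitmx ->
  invmx A - invmx B = - (invmx A *m (A - B) *m invmx B).
Proof.
move=> Au Bu; rewrite mulmxBr mulmxBl mulVmx// mul1mx.
by rewrite -mulmxA mulmxV// mulmx1 opprB.
Qed.

(* The refitted and linearized changes are A* r and A^ r for the same
   r = (g* - g^) - (H* - H^) beta^, because g^ = (H^ + lam) beta^. *)
Lemma ridge_refit_bound d (Hn Hh Hs : 'M[R]_d) (gn gh gs : 'cV[R]_d)
    (lam c G : R) :
  0 < c -> coercive (Hn + lam%:M) c ->
  frob_norm (Hh - Hn) <= c / 4 -> frob_norm (Hs - Hh) <= c / 4 ->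
  frob_norm gn <= G -> frob_norm (gh - gn) <= 1 ->
  frob_norm ((resolvent Hs lam *m gs - resolvent Hh lam *m gh)
    - resolvent Hh lam *m ((gs - gh)
        - (Hs - Hh) *m (resolvent Hh lam *m gh))) <=
  (2 / c) ^+ 2 * frob_norm (Hs - Hh)
    * (frob_norm (gs - gh) + frob_norm (Hs - Hh) * (2 / c * (G + 1))).
Proof.
move=> c0 cHn dHh dHs gnG dgh; set bh := resolvent Hh lam *m gh.
have c2 : 0 < c / 2 by rewrite divr_gt0.
(* One margin c/4 is spent on Hh and two on Hs, so both keep coercivity c/2: the origin of the
   factors 2/c. *)
have cHh : coercive (Hh + lam%:M) (c / 2).
  have : coercive (Hh + lam%:M) (c - c / 4).
    by apply: coercive_perturb cHn _; rewrite opprD addrACA subrr addr0.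
  by apply: coerciveW; lra.
have cHs : coercive (Hs + lam%:M) (c / 2).
  have : coercive (Hs + lam%:M) (c - c / 2).
    apply: coercive_perturb cHn _; rewrite opprD addrACA subrr addr0.
    rewrite -(subrK Hh Hs) -addrA; apply: le_trans (frob_normD _ _) _; lra.
  by apply: coerciveW; lra.
have uh := coercive_unitmx c2 cHh; have us := coercive_unitmx c2 cHs.
set r := (gs - gh) - (Hs - Hh) *m bh.
have rE : r = gs - (Hs + lam%:M) *m bh.
  have ghE : gh = (Hh + lam%:M) *m bh by rewrite /bh /resolvent mulKVmx.
  rewrite /r {1}ghE mulmxBl !mulmxDl.
  move: (Hs *m bh) (Hh *m bh) (lam%:M *m bh) => a b e.
  by apply/matrixP => i j; rewrite !mxE; ring.
have -> : resolvent Hs lam *m gs - bh = resolvent Hs lam *m r.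
  by rewrite rE mulmxBr /resolvent mulKmx.
(* The shift lam cancels between the two matrices, so the resolvent identity leaves Hs - Hh in the
   middle. *)
rewrite -mulmxBl /resolvent invmx_sub// opprD addrACA subrr addr0.
rewrite mulNmx frob_normN -!mulmxA.
have cE : (c / 2)^-1 = 2 / c by rewrite invf_div.
have c2' : 0 <= 2 / c by rewrite divr_ge0// ltW.
move: (2 / c) cE c2' => k cE c2'.
apply: le_trans (coercive_invmx _ c2 cHs) _.
rewrite cE expr2 -!mulrA ler_wpM2l//.
apply: le_trans (frob_norm_mul _ _) _.
rewrite [leRHS]mulrCA ler_wpM2l ?frob_norm_ge0//.
apply: le_trans (coercive_invmx _ c2 cHh) _; rewrite cE ler_wpM2l//.
apply: le_trans (frob_normB _ _) _; rewrite lerD2l.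
apply: le_trans (frob_norm_mul _ _) _; rewrite ler_wpM2l ?frob_norm_ge0//.
apply: le_trans (coercive_invmx _ c2 cHh) _; rewrite cE -?mulrA ler_wpM2l//.
rewrite -(subrK gn gh); apply: le_trans (frob_normD _ _) _.
by rewrite addrC lerD.
Qed.

End Refit.

(** * Moments of multinomial weights *)

Section MultinomialMoments.
Context {R : realType} (m L : nat) (p : 'I_m -> R).
Local Notation box := {ffun 'I_m -> 'I_L.+1}.
Implicit Types (k : 'I_m -> nat) (N : nat).

Lemma multinomial_pmf_ge0 N k : (forall i, 0 <= p i) ->
  0 <= multinomial_pmf N p k.
Proof.
move=> p0; rewrite /multinomial_pmf; case: ifP => // _.
by rewrite mulr_ge0 ?divr_ge0// prodr_ge0// => i _; rewrite exprn_ge0.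
Qed.

Lemma sum_delta i : (\sum_(j < m) (j == i) = 1)%N.
Proof.
by rewrite (bigD1 i)//= eqxx big1 ?addn0// => j /negbTE ->.
Qed.

(** Size-biasing: (N+1)! and (k_i+1)! each shed one factor. It trades a factor k_i for one draw
    fewer, and the total mass and first two moments follow by recursion. *)
Lemma multinomial_pmf_incr N k i :
  multinomial_pmf N.+1 p (fun j => k j + (j == i))%N * (k i).+1%:R =
  N.+1%:R * p i * multinomial_pmf N p k.
Proof.
rewrite /multinomial_pmf big_split/= sum_delta addn1 eqSS.
case: ifP => _; last by rewrite mul0r mulr0.
have -> : (\prod_j (k j + (j == i))`! = (k i).+1 * \prod_j (k j)`!)%N.
  rewrite (bigD1 i)//= [in RHS](bigD1 i)//= eqxx addn1 factS mulnA.
  by congr (_ * _)%N; apply: eq_bigr => j /negbTE ->; rewrite addn0.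
have -> : \prod_j p j ^+ (k j + (j == i)) = p i * \prod_j p j ^+ k j.
  rewrite (bigD1 i)//= [in RHS](bigD1 i)//= eqxx addn1 exprS mulrA.
  by congr (_ * _); apply: eq_bigr => j /negbTE ->; rewrite addn0.
have : \prod_j (k j)`!%:R != 0 :> R.
  by rewrite prodf_seq_neq0; apply/allP => j _; rewrite pnatr_eq0 -lt0n fact_gt0.
rewrite factS !natrM natr_prod => ?; field.
by apply/andP; split.
Qed.

(* Counts are truncated at L, which is harmless as long as N <= L. *)
Definition multinomial_mean N (F : ('I_m -> nat) -> R) : R :=
  \sum_(k : box) multinomial_pmf N p (fun i => k i) * F (fun i => k i).

Lemma multinomial_pmf_neq0 N k : multinomial_pmf N p k != 0 ->
  (\sum_i k i = N)%N.
Proof. by rewrite /multinomial_pmf; case: ifP => [/eqP|]; rewrite ?eqxx. Qed.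

Lemma eq_multinomial_mean N F G :
  (forall k, (\sum_i k i = N)%N -> F k = G k) ->
  multinomial_mean N F = multinomial_mean N G.
Proof.
move=> FG; apply: eq_bigr => k _.
have [->|/multinomial_pmf_neq0/FG ->//] :=
  eqVneq (multinomial_pmf N p (fun i => k i)) 0.
by rewrite !mul0r.
Qed.

Lemma multinomial_meanD N F G :
  multinomial_mean N (fun k => F k + G k) =
  multinomial_mean N F + multinomial_mean N G.
Proof.
by rewrite /multinomial_mean -big_split/=; apply: eq_bigr => k _; rewrite mulrDr.
Qed.

Lemma multinomial_meanZ N c F :
  multinomial_mean N (fun k => c * F k) = c * multinomial_mean N F.
Proof.
by rewrite /multinomial_mean mulr_sumr; apply: eq_bigr => k _; rewrite mulrCA.
Qed.

Lemma multinomial_mean_sum N (I : finType) (F : I -> ('I_m -> nat) -> R) :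
  multinomial_mean N (fun k => \sum_i F i k) =
  \sum_i multinomial_mean N (F i).
Proof.
rewrite /multinomial_mean exchange_big/=.
by apply: eq_bigr => k _; rewrite mulr_sumr.
Qed.

(** Size-biasing summed over the box, along the bijection k -> k + e_i from {k_i < L} onto {k_i >
    0}; N < L leaves room for the added unit. *)
Lemma multinomial_mean_incr N i F : (N < L)%N ->
  multinomial_mean N.+1 (fun k => (k i)%:R * F k) =
  N.+1%:R * p i * multinomial_mean N (fun k => F (fun j => k j + (j == i))%N).
Proof.
move=> NL; rewrite /multinomial_mean mulr_sumr.
rewrite (bigID (fun k : box => 0 < k i)%N)/= [X in _ + X]big1 ?addr0; last first.
  by move=> k; rewrite -eqn0Ngt => /eqP ->; rewrite mul0r mulr0.
pose up (k : box) : box := [ffun j => inord (k j + (j == i))].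
pose down (k : box) : box := [ffun j => inord (k j - (j == i))].
rewrite (reindex_onto up down)/=; last first.
  move=> k ki; apply/ffunP => j; apply: val_inj; rewrite !ffunE /=.
  have [->|_] := eqVneq j i; last by rewrite subn0 !inordK ?addn0 ?inordK.
  rewrite subn1 addn1 (inordK (_ : (k i).-1 < _)%N).
    by rewrite prednK// inordK.
  by apply: leq_ltn_trans (leq_pred _) _.
(* Count vectors with k_i >= L carry no mass, since k_i <= N < L on the support. *)
rewrite [RHS](bigID (fun k : box => k i < L)%N)/= [X in _ = _ + X]big1; last first.
  move=> k; rewrite -leqNgt => Lk.
  have [->|/multinomial_pmf_neq0 kN] :=
    eqVneq (multinomial_pmf N p (fun j => k j)) 0.
    by rewrite mul0r mulr0.
  have : (k i <= N)%N by rewrite -kN (bigD1 i)//= leq_addr.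
  by rewrite leqNgt (leq_trans NL Lk).
rewrite addr0.
have upE (k : box) : (k i < L)%N -> forall j, up k j = (k j + (j == i))%N :> nat.
  move=> kiL j; rewrite ffunE inordK//.
  by have [->|_] := eqVneq j i; rewrite ?addn1 ?addn0// ltnS.
apply: eq_big => [k|k /andP[up0 _]].
  have [kiL|Lk] := ltnP (k i) L.
    rewrite upE// eqxx addn1/=; apply/eqP/ffunP => j; apply: val_inj.
    by rewrite ffunE /= upE// addnK inordK.
  (* At k_i = L the increment overflows and [inord] returns its default 0, so such k fail the filter
     0 < [up k i], as they should. *)
  rewrite ffunE eqxx addn1; have -> : k i = L :> nat.
    by apply/eqP; rewrite eqn_leq Lk -ltnS ltn_ord.
  by rewrite /inord /insubd insubF// ltnn.
have kiL : (k i < L)%N.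
  rewrite ltnNge; apply/negP => Lk; move: up0; rewrite ffunE eqxx addn1.
  have -> : k i = L :> nat by apply/eqP; rewrite eqn_leq Lk -ltnS ltn_ord.
  by rewrite /inord /insubd insubF// ltnn.
rewrite (_ : (fun j => up k j : nat) = (fun j => k j + (j == i))%N); last first.
  by apply/funext => j; exact: upE.
rewrite [RHS]mulrA -multinomial_pmf_incr upE// eqxx addn1.
by rewrite mulrA.
Qed.

Hypothesis p1 : \sum_i p i = 1.

(** Induction on N in place of the multinomial theorem: on the support the counts sum to N+1, and
    size-biasing reduces the mean of each count to the case N. *)
Lemma multinomial_mean_cst N c : (N <= L)%N ->
  multinomial_mean N (fun=> c) = c.
Proof.
suff H : (N <= L)%N -> multinomial_mean N (fun=> 1) = 1.
  by move=> /H NE; rewrite -[in LHS](mulr1 c) multinomial_meanZ NE mulr1.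
elim: N => [_|N IH NL].
  rewrite /multinomial_mean (bigD1 [ffun=> ord0])//= big1 ?addr0.
    rewrite /multinomial_pmf big1 ?eqxx; last by move=> i _; rewrite ffunE.
    rewrite !big1 ?divr1 ?mulr1 ?fact0//.
    + by move=> i _; rewrite ffunE expr0.
    + by move=> i _; rewrite ffunE.
  move=> k k0; rewrite mulr1; apply/eqP; apply: contraNT k0.
  move=> /multinomial_pmf_neq0/eqP; rewrite sum_nat_eq0 => /forallP k0.
  by apply/eqP/ffunP => i; apply: val_inj; rewrite ffunE/=; exact/eqP/k0.
have N0 : N.+1%:R != 0 :> R by rewrite pnatr_eq0.
apply: (mulfI N0); rewrite -multinomial_meanZ mulr1.
transitivity (multinomial_mean N.+1 (fun k => \sum_i (k i)%:R * 1)).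
  apply: eq_multinomial_mean => k kN.
  by under eq_bigr do rewrite mulr1; rewrite -natr_sum kN.
rewrite multinomial_mean_sum.
transitivity (\sum_i N.+1%:R * p i); last by rewrite -mulr_sumr p1 mulr1.
by apply: eq_bigr => i _; rewrite multinomial_mean_incr// IH ?mulr1// ltnW.
Qed.

Lemma multinomial_mean1 N i : (N <= L)%N ->
  multinomial_mean N (fun k => (k i)%:R) = N%:R * p i.
Proof.
case: N => [_|N NL].
  rewrite (@eq_multinomial_mean _ _ (fun=> 0)) ?multinomial_mean_cst ?mul0r//.
  move=> k /eqP; rewrite sum_nat_eq0 => /forallP/(_ i)/= /eqP -> //.
under [X in multinomial_mean _ X]eq_fun do rewrite -[_%:R]mulr1.
by rewrite multinomial_mean_incr// multinomial_mean_cst ?mulr1// ltnW.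
Qed.

(** One draw is spent on i: the other N give count j the mean N p_j, to which the spent draw adds
    one if j = i. *)
Lemma multinomial_mean2 N i j : (N < L)%N ->
  multinomial_mean N.+1 (fun k => (k i)%:R * (k j)%:R) =
  N.+1%:R * p i * (N%:R * p j + (j == i)%:R).
Proof.
move=> NL; rewrite multinomial_mean_incr//; congr (_ * _).
under [X in multinomial_mean _ X]eq_fun do rewrite natrD.
by rewrite multinomial_meanD multinomial_mean_cst ?multinomial_mean1 1?ltnW.
Qed.

End MultinomialMoments.

(* The weights w_i - 1 sum to zero, so a may be centred at any c. *)
Lemma multinomial_resample_var (R : realType) m (a : 'I_m -> R) (c : R) :
  (0 < m)%N ->
  multinomial_mean m (fun=> m%:R^-1) m
    (fun k => (\sum_i ((k i)%:R - 1) * a i) ^+ 2) <= \sum_i (a i - c) ^+ 2.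
Proof.
case: m a => // m a _; set p := fun=> _.
have m0 : m.+1%:R != 0 :> R by rewrite pnatr_eq0.
have p1 : \sum_i p i = 1 :> R.
  by rewrite sumr_const card_ord -(mulr_natl m.+1%:R^-1) mulfV.
pose b i := a i - c; pose B := \sum_i b i.
have E1 : multinomial_mean m.+1 p m.+1 (fun k => \sum_i b i * (k i)%:R) = B.
  rewrite multinomial_mean_sum; apply: eq_bigr => i _.
  by rewrite multinomial_meanZ multinomial_mean1// divff// mulr1.
have E2 : multinomial_mean m.+1 p m.+1
    (fun k => \sum_i \sum_j (b i * b j) * ((k i)%:R * (k j)%:R))
    = m%:R / m.+1%:R * B ^+ 2 + \sum_i b i ^+ 2.
  rewrite multinomial_mean_sum expr2 {1}/B mulr_suml mulr_sumr -big_split/=.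
  apply: eq_bigr => i _; rewrite multinomial_mean_sum /B mulr_sumr mulr_sumr.
  rewrite [X in _ + X](_ : _ = \sum_j b i * b j * (j == i)%:R); last first.
    rewrite (bigD1 i)//= eqxx mulr1 -expr2 big1 ?addr0// => j /negbTE ->.
    by rewrite mulr0.
  rewrite -big_split/=; apply: eq_bigr => j _.
  by rewrite multinomial_meanZ multinomial_mean2// /p; field.
rewrite (@eq_multinomial_mean _ _ _ _ _ _ (fun k =>
    (\sum_i \sum_j (b i * b j) * ((k i)%:R * (k j)%:R) +
     (- 2 * B) * \sum_i b i * (k i)%:R) + B ^+ 2)); last first.
  move=> k kN.
  have -> : \sum_i ((k i)%:R - 1) * a i = \sum_i b i * (k i)%:R - B.
    have k1 : \sum_i (k i)%:R - \sum_(i < m.+1) 1 = 0 :> R.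
      by rewrite -natr_sum kN sumr_const card_ord subrr.
    transitivity (\sum_i ((k i)%:R - 1) * a i
        - c * (\sum_i (k i)%:R - \sum_(i < m.+1) 1)).
      by rewrite k1 mulr0 subr0.
    rewrite /B -!sumrB mulr_sumr -sumrB.
    by apply: eq_bigr => i _; rewrite /b; ring.
  have -> : \sum_i \sum_j (b i * b j) * ((k i)%:R * (k j)%:R)
      = (\sum_i b i * (k i)%:R) ^+ 2.
    rewrite expr2 mulr_suml; apply: eq_bigr => i _; rewrite mulr_sumr.
    by apply: eq_bigr => j _; ring.
  by ring.
rewrite !multinomial_meanD E2 multinomial_meanZ E1 multinomial_mean_cst//.
(* Up to here the second moment is exact; the inequality comes only from dropping the subtracted
   square. *)
rewrite (_ : _ + _ + _ = \sum_i b i ^+ 2 - B ^+ 2 / m.+1%:R); last first.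
  by rewrite -natr1 in m0 *; field.
by rewrite gerBl divr_ge0 ?sqr_ge0.
Qed.

(** * Measurability *)

Section MeasurableMatrices.
Context {R : realType} (disp : measure_display) (T : measurableType disp).

Definition measurable_mx p q (M : T -> 'M[R]_(p, q)) :=
  forall i j, measurable_fun setT (fun x => M x i j).

(* 1 / t = t (t^2)^(-1), and real powers are known to be measurable. *)
Lemma measurable_invr (f : T -> R) :
  measurable_fun setT f -> measurable_fun setT (fun x => (f x)^-1).
Proof.
move=> mf.
rewrite (_ : (fun x => _) = (fun x => f x * (f x ^+ 2) `^ (- 1))).
  apply: measurable_funM => //; apply: (measurableT_comp (measurable_powR _)).
  exact: measurable_funX.
apply/funext => x; rewrite powR_inv1 ?sqr_ge0//.
have [->|fx0] := eqVneq (f x) 0; first by rewrite invr0 mul0r.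
by rewrite expr2 invfM mulrA mulfV// mul1r.
Qed.

Lemma measurable_mx_cst p q (M : 'M[R]_(p, q)) : measurable_mx (fun=> M).
Proof. by move=> i j; exact: measurable_cst. Qed.

Lemma measurable_mxD p q (A B : T -> 'M[R]_(p, q)) :
  measurable_mx A -> measurable_mx B -> measurable_mx (fun x => A x + B x).
Proof.
by move=> mA mB i j; under eq_fun do rewrite mxE; exact: measurable_funD.
Qed.

Lemma measurable_mxZ p q (f : T -> R) (A : T -> 'M[R]_(p, q)) :
  measurable_fun setT f -> measurable_mx A ->
  measurable_mx (fun x => f x *: A x).
Proof.
by move=> mf mA i j; under eq_fun do rewrite mxE; exact: measurable_funM.
Qed.

Lemma measurable_mxB p q (A B : T -> 'M[R]_(p, q)) :
  measurable_mx A -> measurable_mx B -> measurable_mx (fun x => A x - B x).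
Proof.
move=> mA mB; apply: measurable_mxD => // i j.
by under eq_fun do rewrite mxE; apply: measurableT_comp.
Qed.

Lemma measurable_mx_sum p q I (r : seq I) (A : I -> T -> 'M[R]_(p, q)) :
  (forall i, measurable_mx (A i)) ->
  measurable_mx (fun x => \sum_(i <- r) A i x).
Proof.
move=> mA i j; under eq_fun do rewrite summxE.
by apply: measurable_sum => k; exact: mA.
Qed.

Lemma measurable_mx_tr p q (A : T -> 'M[R]_(p, q)) :
  measurable_mx A -> measurable_mx (fun x => (A x)^T).
Proof. by move=> mA i j; under eq_fun do rewrite mxE; exact: mA. Qed.

Lemma measurable_mxM p q r (A : T -> 'M[R]_(p, q)) (B : T -> 'M[R]_(q, r)) :
  measurable_mx A -> measurable_mx B -> measurable_mx (fun x => A x *m B x).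
Proof.
move=> mA mB i j; under eq_fun do rewrite mxE.
by apply: measurable_sum => k; exact: measurable_funM.
Qed.

Lemma measurable_det p (A : T -> 'M[R]_p) :
  measurable_mx A -> measurable_fun setT (fun x => \det (A x)).
Proof.
move=> mA; apply: measurable_sum => s; apply: measurable_funM => //.
by apply: measurable_prod.
Qed.

(** Cramer's rule. Invertibility at every point selects its branch: [invmx] returns a singular
    matrix unchanged. *)
Lemma measurable_invmx p (A : T -> 'M[R]_p) : (forall x, A x \in unitmx) ->
  measurable_mx A -> measurable_mx (fun x => invmx (A x)).
Proof.
move=> Au mA i j.
rewrite (_ : (fun x => _) = (fun x => ((\det (A x))^-1 *: \adj (A x)) i j)).
  apply: measurable_mxZ; first exact/measurable_invr/measurable_det.
  move=> k l; under eq_fun do rewrite mxE.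
  apply: measurable_funM => //; apply: measurable_det => a b.
  by under eq_fun do rewrite !mxE; exact: mA.
by apply/funext => x; rewrite /invmx Au.
Qed.

Lemma measurable_frob_norm p q (A : T -> 'M[R]_(p, q)) :
  measurable_mx A -> measurable_fun setT (fun x => frob_norm (A x)).
Proof.
move=> mA.
have msqrt : measurable_fun setT (@Num.sqrt R).
  by apply: continuous_measurable_fun => ?; exact: sqrt_continuous.
apply: (measurableT_comp msqrt (g := fun x => \sum_i \sum_j A x i j ^+ 2)).
by do 2![apply: measurable_sum => ?]; apply: measurable_funX.
Qed.

Lemma measurable_zrow n d (X : 'M[R]_(n, d)) (s : T -> n.-tuple R) :
  measurable_fun setT s -> measurable_mx (fun x => zrow X (s x)).
Proof.
move=> ms; apply: measurable_mxZ => //.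
apply: (measurable_mxM (measurable_mx_cst _)) => i j.
under eq_fun do rewrite mxE.
exact: (measurableT_comp (measurable_tnth i)).
Qed.

Lemma measurable_uentry n (y : 'cV[R]_n) (s : T -> n.-tuple R) :
  measurable_fun setT s -> measurable_fun setT (fun x => uentry y (s x)).
Proof.
move=> ms; apply: measurable_funM => //.
apply: (measurable_mxM (measurable_mx_cst _)) => i j.
under eq_fun do rewrite mxE.
exact: (measurableT_comp (measurable_tnth i)).
Qed.

End MeasurableMatrices.

(** * Measurability of the bootstrap estimator and of the error event *)

Section MeasurableRefit.
Context {R : realType} {d m : nat} (lam : R).

(** The sketch is the resample with all weights 1, so facts on starred quantities specialize to the
    hatted ones. *)
Lemma Hhat_Hstar (z : 'I_m -> 'cV[R]_d) : Hhat z = Hstar z (fun=> 1%N).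
Proof. by congr (_ *: _); apply: eq_bigr => i _; rewrite scale1r. Qed.

Lemma ghat_gstar (z : 'I_m -> 'cV[R]_d) (u : 'I_m -> R) :
  ghat z u = gstar z u (fun=> 1%N).
Proof. by congr (_ *: _); apply: eq_bigr => i _; rewrite scale1r. Qed.

Lemma betahat_betastar (z : 'I_m -> 'cV[R]_d) (u : 'I_m -> R) :
  betahat z u lam = betastar z u lam (fun=> 1%N).
Proof. by rewrite /betahat /betastar Hhat_Hstar ghat_gstar. Qed.

Lemma gram_coercive n (X : 'M[R]_(n, d)) : coercive (gram X) 0.
Proof.
move=> v; rewrite mul0r -scalemxAr -scalemxAl mxE mulr_ge0//.
have -> : v^T *m (X^T *m X) *m v = (X *m v)^T *m (X *m v).
  by rewrite trmx_mul !mulmxA.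
by rewrite frob_norm_col_dot sqr_ge0.
Qed.

Lemma Hstar_coercive (z : 'I_m -> 'cV[R]_d) w : coercive (Hstar z w) 0.
Proof.
move=> v; rewrite mul0r -scalemxAr -scalemxAl mxE mulr_ge0//.
rewrite mulmx_sumr mulmx_suml summxE; apply: sumr_ge0 => i _.
rewrite -scalemxAr -scalemxAl mxE mulr_ge0//.
have -> : v^T *m (z i *m (z i)^T) *m v = ((z i)^T *m v)^T *m ((z i)^T *m v).
  by rewrite trmx_mul trmxK !mulmxA.
by rewrite frob_norm_col_dot sqr_ge0.
Qed.

Hypothesis lam_gt0 : 0 < lam.

(** Since lam > 0, this holds at every sample point and not only where the deviations are small, as
    [measurable_invmx] demands. *)
Lemma Hstar_unitmx (z : 'I_m -> 'cV[R]_d) w :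
  Hstar z w + lam%:M \in unitmx.
Proof.
apply: (@coercive_unitmx _ _ _ (0 + lam)); first by rewrite add0r.
exact/coercive_scalar_add/Hstar_coercive.
Qed.

Context (disp : measure_display) (T : measurableType disp).
Variables (z : 'I_m -> T -> 'cV[R]_d) (u : 'I_m -> T -> R).
Variable w : 'I_m -> T -> nat.
Hypothesis mz : forall i, measurable_mx (z i).
Hypothesis mu : forall i, measurable_fun setT (u i).
Hypothesis mw : forall i, measurable_fun setT (w i).

Let mwR i : measurable_fun setT (fun x => (w i x)%:R : R).
Proof.
have mnat : measurable_fun setT (fun n : nat => n%:R : R) by [].
exact: (measurableT_comp mnat).
Qed.

Lemma measurable_Hstar :
  measurable_mx (fun x => Hstar (z ^~ x) (w ^~ x)).
Proof.
apply: measurable_mxZ => //; apply: measurable_mx_sum => i.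
by apply: measurable_mxZ => //; apply: measurable_mxM => //;
  exact: measurable_mx_tr.
Qed.

Lemma measurable_gstar :
  measurable_mx (fun x => gstar (z ^~ x) (u ^~ x) (w ^~ x)).
Proof.
apply: measurable_mxZ => //; apply: measurable_mx_sum => i.
by apply: measurable_mxZ => //; exact: measurable_mxZ.
Qed.

Lemma measurable_betastar :
  measurable_mx (fun x => betastar (z ^~ x) (u ^~ x) lam (w ^~ x)).
Proof.
apply: measurable_mxM; last exact: measurable_gstar.
apply: measurable_invmx => [x|]; first exact: Hstar_unitmx.
by apply: measurable_mxD; [exact: measurable_Hstar|exact: measurable_mx_cst].
Qed.

End MeasurableRefit.

Lemma measurable_refit_error (R : realType) d m (lam eps r : R)
    (disp : measure_display) (T : measurableType disp)
    (z : 'I_m -> T -> 'cV[R]_d) (u : 'I_m -> T -> R) (w : 'I_m -> T -> nat) :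
  0 < lam -> (forall i, measurable_mx (z i)) ->
  (forall i, measurable_fun setT (u i)) ->
  (forall i, measurable_fun setT (w i)) ->
  measurable [set x | eps < r * norm2
    ((betastar (z ^~ x) (u ^~ x) lam (w ^~ x) - betahat (z ^~ x) (u ^~ x) lam)
     - lin_change (z ^~ x) (u ^~ x) lam (w ^~ x))].
Proof.
move=> lam0 mz mu mw.
have mw1 (i : 'I_m) : measurable_fun setT ((fun=> cst 1%N) i : T -> nat).
  exact: measurable_cst.
have mbh : measurable_mx (fun x => betahat (z ^~ x) (u ^~ x) lam).
  under eq_fun do rewrite betahat_betastar.
  exact: (measurable_betastar lam0 mz mu mw1).
have mHh : measurable_mx (fun x => Hhat (z ^~ x)).
  under eq_fun do rewrite Hhat_Hstar; exact: (measurable_Hstar mz mw1).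
have mgh : measurable_mx (fun x => ghat (z ^~ x) (u ^~ x)).
  under eq_fun do rewrite ghat_gstar; exact: (measurable_gstar mz mu mw1).
have mfun : measurable_fun setT (fun x => r * norm2
    ((betastar (z ^~ x) (u ^~ x) lam (w ^~ x) - betahat (z ^~ x) (u ^~ x) lam)
     - lin_change (z ^~ x) (u ^~ x) lam (w ^~ x))).
  under eq_fun do rewrite norm2E; apply: measurable_funM => //.
  apply: measurable_frob_norm; apply: measurable_mxB.
    by apply: measurable_mxB => //; exact: measurable_betastar.
  apply: measurable_mxM.
    apply: measurable_invmx => [x|]; first by rewrite Hhat_Hstar Hstar_unitmx.
    by apply: measurable_mxD => //; exact: measurable_mx_cst.
  apply: measurable_mxB.
    by apply: measurable_mxB => //; exact: measurable_gstar.
  by apply: measurable_mxM => //; apply: measurable_mxB => //;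
    exact: measurable_Hstar.
by have := measurable_fun_ltr (measurable_cst eps) mfun;
  move=> /(_ measurableT [set true]); rewrite setTI; apply.
Qed.

(** * Sample means of independent rows *)

Section IndependentMean.
Context {R : realType} (disp : measure_display) (T : measurableType disp).
Variable P : probability T R.

(** The joint law agrees with the product of the marginals on rectangles, hence everywhere; Fubini
    then leaves the inner integral x E Y = 0. *)
Lemma independent_mul_mean0 (X Y : {mfun T >-> R}) :
  (forall A B : set R, measurable A -> measurable B ->
    P (X @^-1` A `&` Y @^-1` B) = (P (X @^-1` A) * P (Y @^-1` B))%E) ->
  P.-integrable setT (fun x => (X x * Y x)%:E) ->
  P.-integrable setT (fun x => (Y x)%:E) ->
  (\int[P]_x (Y x)%:E = 0)%E -> (\int[P]_x (X x * Y x)%:E = 0)%E.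
Proof.
move=> XY iXY iY Y0.
have mXY : measurable_fun setT (fun x => (X x, Y x)).
  exact: measurable_fun_pair.
pose XY_mfun : {mfun T >-> (R * R)%type} :=
  HB.pack (fun x => (X x, Y x)) (isMeasurableFun.Build _ _ _ _ _ mXY).
pose mu : {measure set (R * R)%type -> \bar R} := distribution P XY_mfun.
pose f (z : (R * R)%type) : \bar R := (z.1 * z.2)%:E.
have mf : measurable_fun setT f.
  by apply/measurable_EFinP; apply: measurable_funM.
have muE A : measurable A ->
    (distribution P X \x distribution P Y)%E A = mu A.
  by move=> mA; apply: product_measure_unique => // B C mB mC; exact: XY.
transitivity (\int[mu]_z f z)%E.
  by rewrite integral_distribution.
transitivity (\int[(distribution P X \x distribution P Y)%E]_z f z)%E.
  by apply: eq_measure_integral => A mA _; apply/esym; exact: muE.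
rewrite -integral12_prod_meas1; last first.
  apply/integrableP; split => //.
  rewrite (eq_measure_integral mu) => [|A mA _]; last exact: muE.
  rewrite ge0_integral_distribution//; last exact: measurableT_comp.
  by move/integrableP : iXY => [].
rewrite integral0_eq// => x _; rewrite /fubini_F /f/=.
under eq_integral do rewrite EFinM.
have iY' : (distribution P Y).-integrable setT EFin.
  apply/integrableP; split => //.
  rewrite ge0_integral_distribution//; last exact: measurableT_comp.
  by move/integrableP : iY => [].
rewrite integralZl//.
by rewrite integral_distribution// [X in (_ * X)%E]Y0 mule0.
Qed.

End IndependentMean.

Section SampleMean.
Context {R : realType} (disp : measure_display) (T : measurableType disp).
Variable P : probability T R.
Context (dE : measure_display) (E : measurableType dE) (m : nat).
Variable s : 'I_m -> {RV P >-> E}.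
Hypothesis s_indep : mutually_independent s.
Hypothesis s_ident : identically_distributed s.
Variable i0 : 'I_m.

Let ms i : measurable_fun setT (s i : T -> E). Proof. by []. Qed.

Lemma ident_ge0_integral (h : E -> \bar R) i :
  measurable_fun setT h -> (forall v, 0 <= h v)%E ->
  (\int[P]_x h (s i x) = \int[P]_x h (s i0 x))%E.
Proof.
move=> mh h0; rewrite -!ge0_integral_distribution//.
by apply: eq_measure_integral => A mA _; exact: s_ident.
Qed.

Lemma ident_integrable (h : E -> \bar R) i : measurable_fun setT h ->
  P.-integrable setT (h \o s i0) -> P.-integrable setT (h \o s i).
Proof.
move=> mh /integrableP[_ hoo]; apply/integrableP; split.
  exact: measurableT_comp.
have := @ident_ge0_integral (abse \o h) i.
by rewrite /= => ->//; exact: measurableT_comp.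
Qed.

Lemma ident_integral (h : E -> \bar R) i : measurable_fun setT h ->
  P.-integrable setT (h \o s i0) ->
  (\int[P]_x h (s i x) = \int[P]_x h (s i0 x))%E.
Proof.
move=> mh ih; rewrite -!integral_distribution//; last exact: ident_integrable.
by apply: eq_measure_integral => A mA _; exact: s_ident.
Qed.

Lemma independent_pair (f : E -> R) i j (A B : set R) :
  measurable_fun setT f -> i != j -> measurable A -> measurable B ->
  P ((f \o s i) @^-1` A `&` (f \o s j) @^-1` B) =
  (P ((f \o s i) @^-1` A) * P ((f \o s j) @^-1` B))%E.
Proof.
move=> mf ij mA mB.
pose C k := if k == i then f @^-1` A else f @^-1` B.
have mC k : measurable (C k).
  by rewrite /C -[f @^-1` A]setTI -[f @^-1` B]setTI; case: ifP => _; exact: mf.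
have := @s_indep [set i; j]%SET C mC.
rewrite big_setU1/= ?inE// big_set1 /C eqxx eq_sym (negbTE ij) => <-.
congr (P _); apply/seteqP; split=> x /=.
  move=> [Ax Bx] k; rewrite /= !inE => /orP[|] /eqP ->; first by rewrite eqxx.
  by rewrite eq_sym (negbTE ij).
move=> H; split; first by have := H i; rewrite /= !inE eqxx; apply.
by have := H j; rewrite /= !inE eqxx orbT eq_sym (negbTE ij); apply.
Qed.

Variables (f : E -> R) (c M : R).
Hypothesis mf : measurable_fun setT f.
Hypothesis f_int : P.-integrable setT (EFin \o (f \o s i0)).
Hypothesis f_mean : (\int[P]_x (f (s i0 x))%:E = c%:E)%E.
Hypothesis f_var : (\int[P]_x ((f (s i0 x) - c) ^+ 2)%:E <= M%:E)%E.

Let g v := f v - c.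
Let mg : measurable_fun setT g. Proof. exact: measurable_funB. Qed.
Let mgs i : measurable_fun setT (g \o s i). Proof. exact: measurableT_comp. Qed.

Lemma centered_sqr_le i : (\int[P]_x ((f (s i x) - c) ^+ 2)%:E <= M%:E)%E.
Proof.
rewrite (@ident_ge0_integral (fun v => (g v ^+ 2)%:E)).
- exact: f_var.
- by apply/measurable_EFinP; exact: measurable_funX.
- by move=> v; rewrite lee_fin sqr_ge0.
Qed.

Let g_sqr_int i : P.-integrable setT (fun x => (g (s i x) ^+ 2)%:E).
Proof.
apply/integrableP; split.
  by apply/measurable_EFinP; apply: measurable_funX; exact: mgs.
under eq_integral do rewrite /= ger0_norm ?sqr_ge0//.
exact: le_lt_trans (centered_sqr_le i) (ltry _).
Qed.

Let g_mul_int i j : P.-integrable setT (fun x => (g (s i x) * g (s j x))%:E).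
Proof.
apply: (@le_integrable _ _ _ _ _ measurableT _
  (fun x => (g (s i x) ^+ 2)%:E + (g (s j x) ^+ 2)%:E)%E).
- by apply/measurable_EFinP; apply: measurable_funM; exact: mgs.
- move=> x _; rewrite /= lee_fin normrM [leRHS]ger0_norm ?addr_ge0 ?sqr_ge0//.
  rewrite -[g (s i x) ^+ 2]real_normK ?num_real//.
  rewrite -[g (s j x) ^+ 2]real_normK ?num_real//.
  by have := sqr_ge0 (`|g (s i x)| - `|g (s j x)|); have := normr_ge0 (g (s i x));
    have := normr_ge0 (g (s j x)); nra.
- exact: integrableD.
Qed.

Let g_int i : P.-integrable setT (fun x => (g (s i x))%:E).
Proof.
apply: (@ident_integrable (EFin \o g)); first exact/measurable_EFinP.
rewrite (_ : _ \o _ = (EFin \o (f \o s i0)) \- (cst c%:E))%E.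
  by apply: integrableB => //; exact: finite_measure_integrable_cst.
by apply/funext => x; rewrite /= EFinB.
Qed.

Let g_mean i : (\int[P]_x (g (s i x))%:E = 0)%E.
Proof.
rewrite (@ident_integral (EFin \o g)).
- under eq_integral do rewrite /= EFinB.
  rewrite integralB//=; last exact: finite_measure_integrable_cst.
  rewrite f_mean integral_cst// [X in (_ * X)%E](_ : _ = 1%E) ?mule1 ?subee//.
  exact: probability_setT.
- exact/measurable_EFinP.
- exact: (g_int i0).
Qed.

(** In the expanded square the off-diagonal products integrate to zero by independence, and the m
    diagonal ones are at most M each, against the factor m^(-2). *)
Lemma sample_mean_var :
  (\int[P]_x ((m%:R^-1 * (\sum_i f (s i x)) - c) ^+ 2)%:E <= (M / m%:R)%:E)%E.
Proof.
have m0 : m%:R != 0 :> R by rewrite pnatr_eq0 -lt0n (leq_ltn_trans _ (ltn_ord i0)).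
have E1 x : m%:R^-1 * (\sum_i f (s i x)) - c = m%:R^-1 * \sum_i g (s i x).
  rewrite /g sumrB mulrBr sumr_const card_ord -(mulr_natl c); congr (_ - _).
  by rewrite mulrA mulVf// mul1r.
have E2 x : ((m%:R^-1 * (\sum_i f (s i x)) - c) ^+ 2)%:E =
    (((m%:R^-1) ^+ 2)%:E * (\sum_i \sum_j (g (s i x) * g (s j x))%:E))%E.
  transitivity ((m%:R^-1) ^+ 2 * \sum_i \sum_j (g (s i x) * g (s j x)))%:E.
    rewrite E1 exprMn; congr (_ * _)%:E; rewrite expr2 mulr_suml.
    by apply: eq_bigr => i _; rewrite mulr_sumr.
  rewrite EFinM -sumEFin; congr (_ * _)%E.
  by apply: eq_bigr => i _; rewrite -sumEFin.
under eq_integral do rewrite E2.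
rewrite integralZl//; last first.
  by apply: integrable_sum => // i _; exact: integrable_sum.
rewrite integral_sum//; last by move=> i; exact: integrable_sum.
under eq_bigr do rewrite integral_sum//.
rewrite (_ : M / m%:R = (m%:R^-1) ^+ 2 * \sum_(i < m) M); last first.
  by rewrite sumr_const card_ord -(mulr_natl M); field.
rewrite [leRHS]EFinM; apply: lee_wpmul2l; first by rewrite lee_fin sqr_ge0.
rewrite -sumEFin.
apply: lee_sum => i _; rewrite (bigD1 i)//= big1 ?adde0.
  by apply: le_trans (centered_sqr_le i); under eq_integral do rewrite -expr2.
move=> j ji.
pose X : {mfun T >-> R} := HB.pack (g \o s i) (isMeasurableFun.Build _ _ _ _ _ (mgs i)).
pose Y : {mfun T >-> R} := HB.pack (g \o s j) (isMeasurableFun.Build _ _ _ _ _ (mgs j)).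
apply: (@independent_mul_mean0 _ _ _ P X Y) => //.
- by move=> A B mA mB; apply: independent_pair => //; rewrite eq_sym.
- exact: g_mul_int.
- exact: g_int.
- exact: g_mean.
Qed.

End SampleMean.

(** * Bootstrap events *)

Section MultinomialWeights.
Context {R : realType} (disp : measure_display) (T : measurableType disp).
Variable P : probability T R.

Lemma measure_bigcup_finType (I : finType) (F : I -> set T) :
  (forall i, measurable (F i)) -> trivIset setT F ->
  (P (\bigcup_i F i) = \sum_i P (F i))%E.
Proof.
move=> mF tF; rewrite measure_fin_bigcup//; last exact: finite_finset.
rewrite [RHS](fsbig_seq _ _ (index_enum_uniq I)).
rewrite (_ : [set` index_enum I] = setT)//.
by apply/seteqP; split=> i //= _; exact: mem_index_enum.
Qed.

Variables (G : set (set T)) (m : nat) (w : nat -> 'I_m -> {RV P >-> nat}).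
Hypothesis GT : G setT.
Hypothesis w_mult : multinomial_weights G w.
Hypothesis m_gt0 : (0 < m)%N.
Local Notation box := {ffun 'I_m -> 'I_m.+1}.
Let pmf (k : 'I_m -> nat) : R := multinomial_pmf m (fun=> m%:R^-1) k.

Let pmf_sum : \sum_(k : box) pmf (fun i => k i) = 1.
Proof.
rewrite -[RHS](@multinomial_mean_cst R m m (fun=> m%:R^-1) _ m 1)//.
  by apply: eq_bigr => k _; rewrite mulr1.
by rewrite sumr_const card_ord -(mulr_natl m%:R^-1) mulfV// pnatr_eq0 -lt0n.
Qed.

Variable b : nat.
(** Counts are capped at m, beyond which the mass is zero, so that histories are indexed by a finite
    type. *)
Let history (K : {ffun 'I_b.+1 -> box}) : set T :=
  [set x | forall c i, (c < b.+1)%N -> w c i x = K (inord c) i].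

Let mhistory K : measurable (history K).
Proof.
have -> : history K = \bigcap_(c : 'I_b.+1) \bigcap_(i : 'I_m)
    (w c i @^-1` [set (K c i : nat)]).
  apply/seteqP; split=> x /= h.
    by move=> c _ i _ /=; rewrite h// inord_val.
  by move=> c i cb; have := h (inord c) I i I; rewrite /= inordK.
apply: fin_bigcap_measurable => [|c _]; first exact: finite_finset.
apply: fin_bigcap_measurable => [|i _]; first exact: finite_finset.
exact: measurable_funPTI.
Qed.

Let trivIset_history : trivIset setT history.
Proof.
move=> K L _ _ [x [Kx Lx]]; apply/ffunP => c; apply/ffunP => i.
apply: val_inj => /=.
by have := Kx c i (ltn_ord c); rewrite (Lx c i (ltn_ord c)) inord_val.
Qed.

Let weight (K : {ffun 'I_b.+1 -> box}) : R :=
  \prod_(c < b.+1) pmf (fun i => K c i).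

(* [multinomial_weights] only gives the joint laws of initial segments of the
   replicates, so A is split according to the history of replicates 0, ..., b. *)
Lemma multinomial_prob_le (A : set T) (Ak : ('I_m -> nat) -> set T) :
  measurable A -> (forall k, measurable (Ak k)) -> (forall k, G (Ak k)) ->
  (forall x, A x -> Ak (fun i => w b i x) x) ->
  (P A <= \sum_(k : box) (pmf (fun i => k i))%:E * P (Ak (fun i => k i)))%E.
Proof.
move=> mA mAk GAk AAk.
pose lst : 'I_b.+1 := ord_max.
(* The conditional probability has a constant version; integrating it over B in G gives a product
   rule between history and sketch event. *)
have hprob K B : measurable B -> G B ->
    P (history K `&` B) = ((weight K)%:E * P B)%E.
  move=> mB GB.
  have [_ _ /(_ B GB) <-] := w_mult b.+1 (fun c i => K (inord c) i).
  rewrite -integral_cst//; apply: eq_integral => x _; congr (_%:E).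
  by apply: eq_bigr => c _; rewrite inord_val.
pose U := \bigcup_K history K.
have mU : measurable U by apply: fin_bigcup_measurable => //; exact: finite_finset.
(* The masses of the capped histories sum to one, so whatever lies outside all of them is
   negligible. *)
have PU : P U = 1%E.
  rewrite measure_bigcup_finType//.
  under eq_bigr => K _ do rewrite -[history K]setIT hprob// probability_setT mule1.
  rewrite sumEFin -(bigA_distr_bigA (fun _ (k : box) => pmf (fun i => k i))).
  by rewrite big1// => c _; exact: pmf_sum.
pose F (K : {ffun 'I_b.+1 -> box}) := Ak (fun i => K lst i) `&` history K.
have mF K : measurable (F K) by exact: measurableI.
have tF : trivIset setT F.
  move=> K L _ _ [x [[_ Kx] [_ Lx]]]; apply: trivIset_history => //.
  by exists x.
have AF : A `<=` (\bigcup_K F K) `|` ~` U.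
  move=> x Ax; have [[K _ Kx]|nUx] := pselect (U x); last by right.
  left; exists K => //; split=> //.
  have := AAk x Ax; congr (Ak _ x); apply/funext => i.
  rewrite Kx//; congr (_ (K _ i)).
  by apply: val_inj; rewrite /= inordK.
have mUF : measurable (\bigcup_K F K).
  by apply: fin_bigcup_measurable => //; exact: finite_finset.
apply: (@le_trans _ _ (P ((\bigcup_K F K) `|` ~` U))).
  by apply: le_measure => //; rewrite inE//; apply: measurableU => //; exact: measurableC.
apply: (@le_trans _ _ (P (\bigcup_K F K) + P (~` U))%E).
  exact: measureU2 (measurableC mU).
rewrite probability_setC// PU subee// adde0 measure_bigcup_finType//.
pose p (k : 'I_m -> nat) := fine (P (Ak k)).
have pE k : P (Ak k) = (p k)%:E by rewrite fineK// fin_num_measure.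
under eq_bigr => K _ do rewrite /F setIC hprob// pE -EFinM.
under [leRHS]eq_bigr => k _ do rewrite pE -EFinM.
rewrite !sumEFin lee_fin le_eqVlt; apply/orP; left; apply/eqP.
(* [h] attaches the event's probability to replicate b only; the sum over histories factorizes over
   replicates, and the other factors sum to 1. *)
pose h (c : 'I_b.+1) (k : box) :=
  pmf (fun i => k i) * (if c == lst then p (fun i => k i) else 1).
transitivity (\sum_(K : {ffun 'I_b.+1 -> box}) \prod_c h c (K c)).
  apply: eq_bigr => K _; rewrite /h big_split/= -big_mkcond big_pred1_eq.
  by [].
rewrite -bigA_distr_bigA/= (bigD1 lst)//= [X in _ * X]big1 ?mulr1.
  by apply: eq_bigr => k _; rewrite /h eqxx.
move=> c /negbTE cl; rewrite -[RHS]pmf_sum.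
by apply: eq_bigr => k _; rewrite /h cl mulr1.
Qed.

End MultinomialWeights.

Lemma g_sigma_preimage_sub (T : Type) dE (E : measurableType dE) m
    (s : 'I_m -> T -> E) i (B : set E) :
  measurable B -> g_sigma_preimage s (s i @^-1` B).
Proof.
move=> mB; apply: sub_sigma_algebra; rewrite -bigcup_seq/=.
exists i; first by rewrite /= mem_index_enum.
by exists B => //; rewrite setTI.
Qed.

Section BootstrapBound.
Context {R : realType} (disp : measure_display) (T : measurableType disp).
Variable P : probability T R.
Context (dE : measure_display) (E : measurableType dE) (m : nat).
Context (I : finType) (f : I -> E -> R) (c : I -> R).
Hypothesis mf : forall e, measurable_fun setT (f e).

(* The factor sqrt m is what the second-order term sqrt m |H* - H^|^2 requires. *)
Definition boot_dev (v : 'I_m -> E) (k : 'I_m -> nat) : R :=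
  \sum_e ((m%:R^-1 * (\sum_i f e (v i)) - c e) ^+ 2
    + Num.sqrt m%:R * (m%:R^-1 * \sum_i ((k i)%:R - 1) * f e (v i)) ^+ 2).

Lemma boot_dev_ge0 v k : 0 <= boot_dev v k.
Proof.
by apply: sumr_ge0 => e _; rewrite addr_ge0 ?sqr_ge0// mulr_ge0 ?sqr_ge0.
Qed.

(** The space is arbitrary because two sigma-algebras are needed: that of T and the one generated by
    the sketch. *)
Lemma measurable_boot_dev d' (T' : measurableType d') (s : 'I_m -> T' -> E) k :
  (forall i, measurable_fun setT (s i)) ->
  measurable_fun setT (fun x => boot_dev (s ^~ x) k).
Proof.
move=> ms; have mfs e i : measurable_fun setT (fun x => f e (s i x)).
  exact: measurableT_comp.
apply: measurable_sum => e; apply: measurable_funD.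
  apply: measurable_funX; apply: measurable_funB => //.
  by apply: measurable_funM => //; exact: measurable_sum.
apply: measurable_funM => //; apply: measurable_funX.
apply: measurable_funM => //; apply: measurable_sum => i.
exact: measurable_funM.
Qed.

(** The sketch part is constant in the weights. Centring the other at [c e] instead of the sample
    mean leaves a sum of functions of single rows, whose expectations are bounded by the variance of
    one row. *)
Lemma mean_boot_dev_le (v : 'I_m -> E) : (0 < m)%N ->
  multinomial_mean m (fun=> m%:R^-1) m (boot_dev v) <=
  \sum_e ((m%:R^-1 * (\sum_i f e (v i)) - c e) ^+ 2
    + Num.sqrt m%:R * m%:R^-1 ^+ 2 * \sum_i (f e (v i) - c e) ^+ 2).
Proof.
move=> m0; rewrite multinomial_mean_sum; apply: ler_sum => e _.
rewrite multinomial_meanD multinomial_mean_cst//; last first.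
  by rewrite sumr_const card_ord -(mulr_natl m%:R^-1) mulfV// pnatr_eq0 -lt0n.
rewrite lerD2l.
under [X in multinomial_mean _ _ _ X]eq_fun do rewrite exprMn mulrA.
rewrite multinomial_meanZ ler_wpM2l ?mulr_ge0 ?sqr_ge0//.
exact: multinomial_resample_var.
Qed.

Variable s : 'I_m -> {RV P >-> E}.
Hypothesis s_indep : mutually_independent s.
Hypothesis s_ident : identically_distributed s.
Variable w : nat -> 'I_m -> {RV P >-> nat}.
Hypothesis w_mult : multinomial_weights (g_sigma_preimage s) w.
Variables (i0 : 'I_m) (M : R).
Hypothesis f_int : forall e, P.-integrable setT (EFin \o (f e \o s i0)).
Hypothesis f_mean : forall e, (\int[P]_x (f e (s i0 x))%:E = (c e)%:E)%E.
Hypothesis f_var :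
  forall e, (\int[P]_x ((f e (s i0 x) - c e) ^+ 2)%:E <= M%:E)%E.

(** Per feature, the sketch deviation contributes M/m and the resampling one sqrt m times m^(-2)
    times m M. *)
Lemma bootstrap_prob_le (A : set T) b (eta : R) : measurable A -> 0 < eta ->
  (forall x, A x -> eta <= boot_dev (fun i => s i x) (fun i => w b i x)) ->
  (P A <= (eta^-1 * (#|I|%:R * ((1 + Num.sqrt m%:R) * (M / m%:R))))%:E)%E.
Proof.
move=> mA eta0 Adev.
have m0 : (0 < m)%N by exact: leq_ltn_trans (ltn_ord i0).
have ms i : measurable_fun setT (s i : T -> E) by [].
pose D k x := boot_dev (fun i => s i x) k.
pose Ak k := [set x | eta <= D k x].
have AkE k : Ak k = D k @^-1` `[eta, +oo[.
  by apply/seteqP; split=> x; rewrite /= in_itv/= andbT.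
have mD k : measurable_fun setT (D k) by exact: measurable_boot_dev.
have mAk k : measurable (Ak k).
  by rewrite AkE -[X in measurable X]setTI; exact: mD.
(* The product rule for the weights covers events of the sketch sigma-algebra only, hence the copy
   [T'] of the space carrying it. *)
have GAk k : g_sigma_preimage s (Ak k).
  pose T' := g_sigma_algebraType (\big[setU/set0]_(i < m)
    preimage_set_system setT (s i : T -> E) measurable).
  have ms' i : measurable_fun setT (s i : T' -> E).
    by move=> _ B mB; rewrite setTI; exact: g_sigma_preimage_sub.
  have := @measurable_boot_dev _ T' s k ms' measurableT _ (measurable_itv `[eta, +oo[).
  by rewrite setTI AkE.
have GT : g_sigma_preimage s setT.
  exact: (@measurableT _ (g_sigma_algebraType (\big[setU/set0]_(i < m)
    preimage_set_system setT (s i : T -> E) measurable))).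
apply: le_trans (multinomial_prob_le GT w_mult m0 mA mAk GAk Adev) _.
set pmf := fun k : 'I_m -> nat => multinomial_pmf m (fun=> m%:R^-1 : R) k.
have pmf0 k : 0 <= pmf k by apply: multinomial_pmf_ge0 => i; rewrite invr_ge0.
pose V e x := (m%:R^-1 * (\sum_i f e (s i x)) - c e) ^+ 2.
pose S e x := \sum_i (f e (s i x) - c e) ^+ 2.
pose W x := \sum_e (V e x + Num.sqrt m%:R * m%:R^-1 ^+ 2 * S e x).
have mfs e i : measurable_fun setT (fun x => f e (s i x)).
  by apply: measurableT_comp.
have mV e : measurable_fun setT (V e).
  apply: measurable_funX; apply: measurable_funB => //.
  by apply: measurable_funM => //; exact: measurable_sum.
have mc e i : measurable_fun setT (fun x => (f e (s i x) - c e) ^+ 2).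
  by apply: measurable_funX; exact: measurable_funB.
have mS e : measurable_fun setT (S e) by exact: measurable_sum.
have V0 e x : 0 <= V e x by exact: sqr_ge0.
have S0 e x : 0 <= S e x by apply: sumr_ge0 => i _; exact: sqr_ge0.
have r0 : 0 <= Num.sqrt m%:R * m%:R^-1 ^+ 2 :> R.
  by rewrite mulr_ge0 ?sqr_ge0.
(* Markov's inequality under the integral: each indicator is at most [eta^-1] times the statistic,
   which the masses [pmf k] then average. *)
apply: (@le_trans _ _ (\int[P]_x (eta^-1 * W x)%:E)%E).
  rewrite [leLHS](_ : _ = \int[P]_x
     (\sum_(k : {ffun 'I_m -> 'I_m.+1})
        ((pmf (fun i => k i) * \1_(Ak (fun i => k i)) x)%:E))%E)%E; last first.
    rewrite ge0_integral_sum//.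
    - apply: eq_bigr => k _; under eq_integral do rewrite EFinM.
      rewrite ge0_integralZl_EFin//.
      + by rewrite integral_indic// setIT.
      + by apply/measurable_EFinP.
    - move=> k; apply/measurable_EFinP; exact: measurable_funM.
    - by move=> k x _; rewrite lee_fin mulr_ge0.
  apply: ge0_le_integral => //.
  - by move=> x _; apply: sume_ge0 => k _; rewrite lee_fin mulr_ge0.
  - apply: emeasurable_sum => k.
    by apply/measurable_EFinP; exact: measurable_funM.
  - apply/measurable_EFinP; apply: measurable_funM => //.
    apply: measurable_sum => e; apply: measurable_funD => //.
    exact: measurable_funM.
  - move=> x _; rewrite sumEFin lee_fin ler_pdivlMl//.
    apply: le_trans (mean_boot_dev_le _ m0).
    rewrite mulr_sumr; apply: ler_sum => k _; rewrite mulrCA ler_wpM2l//.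
    rewrite indicE; case: (boolP (x \in _)) => [|_].
      by rewrite inE mulr1.
    by rewrite mulr0 boot_dev_ge0.
under eq_integral do rewrite EFinM -sumEFin.
rewrite ge0_integralZl_EFin//; last 3 first.
- by move=> x _; apply: sume_ge0 => e _; rewrite lee_fin addr_ge0// mulr_ge0.
- apply: emeasurable_sum => e; apply/measurable_EFinP.
  by apply: measurable_funD => //; exact: measurable_funM.
- by rewrite invr_ge0 ltW.
rewrite EFinM; apply: lee_wpmul2l; first by rewrite lee_fin invr_ge0 ltW.
rewrite ge0_integral_sum//; last 2 first.
- move=> e; apply/measurable_EFinP.
  by apply: measurable_funD => //; exact: measurable_funM.
- by move=> e x _; rewrite lee_fin addr_ge0// mulr_ge0.
rewrite mulr_natl -sumr_const -sumEFin; apply: lee_sum => e _.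
under eq_integral do rewrite EFinD.
rewrite ge0_integralD//; last 4 first.
- by move=> x _; rewrite lee_fin.
- exact/measurable_EFinP.
- by move=> x _; rewrite lee_fin mulr_ge0.
- by apply/measurable_EFinP; exact: measurable_funM.
rewrite mulrDl mul1r EFinD; apply: leeD; first exact: sample_mean_var.
under eq_integral do rewrite EFinM -sumEFin.
rewrite ge0_integralZl_EFin//; last 2 first.
- by move=> x _; apply: sume_ge0 => i _; rewrite lee_fin sqr_ge0.
- by apply: emeasurable_sum => i; exact/measurable_EFinP.
rewrite ge0_integral_sum//; last 2 first.
- by move=> i; exact/measurable_EFinP.
- by move=> i x _; rewrite lee_fin sqr_ge0.
rewrite (_ : Num.sqrt m%:R * (M / m%:R) =
    Num.sqrt m%:R * m%:R^-1 ^+ 2 * \sum_(i < m) M); last first.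
  rewrite sumr_const card_ord -(mulr_natl M); field.
  by rewrite pnatr_eq0 -lt0n.
rewrite [leRHS]EFinM; apply: lee_wpmul2l; first by rewrite lee_fin.
rewrite -sumEFin; apply: lee_sum => i _.
exact: (centered_sqr_le s_ident (mf e) (f_var e)).
Qed.

End BootstrapBound.

(** * Markov's inequality for versions of a conditional probability *)

Section ConditionalMarkov.
Context {R : realType} (disp : measure_display) (T : measurableType disp).
Variable P : probability T R.

(** A version may be negative somewhere, so |q| > delta splits in two. The part q < -delta is null:
    there q integrates to a probability, which is nonnegative. *)
Lemma cond_prob_markov (G : set (set T)) (A : set T) (q : T -> R) (delta : R) :
  G `<=` measurable -> measurable A -> is_cond_prob P G A q -> 0 < delta ->
  (P [set x | (delta < `|q x|)%R] <= (delta^-1)%:E * P A)%E.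
Proof.
move=> Gm mA [Gq iq qA] d0.
pose Bp := q @^-1` `]delta, +oo[; pose Bn := q @^-1` `]-oo, (- delta)%R[.
have GBp : G Bp by apply: Gq; exact: measurable_itv.
have GBn : G Bn by apply: Gq; exact: measurable_itv.
have mBp := Gm _ GBp; have mBn := Gm _ GBn.
have iqS B : measurable B -> P.-integrable B (EFin \o q).
  by move=> mB; apply: integrableS iq.
have icst B r : measurable B -> P.-integrable B (EFin \o cst r).
  by move=> mB; exact: finite_measure_integrable_cst.
have PBn : P Bn = 0%E.
  have h : (\int[P]_(x in Bn) (q x)%:E <= \int[P]_(x in Bn) (cst (- delta) x)%:E)%E.
    apply: le_integral => //; [exact: iqS|exact: icst|].
    by move=> x; rewrite inE /Bn/= in_itv/= lee_fin => /ltW.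
  move: h; rewrite qA// (integral_cst P mBn (- delta)%:E) => h.
  have : (0 <= (- delta)%:E * P Bn)%E by exact: le_trans (measure_ge0 _ _) h.
  rewrite -[P Bn]fineK ?fin_num_measure// -EFinM lee_fin nmulr_rge0 ?oppr_lt0//.
  by move=> p0; congr _%:E; apply/eqP; rewrite eq_le p0 fine_ge0.
have PBp : (P Bp <= (delta^-1)%:E * P A)%E.
  have h : (\int[P]_(x in Bp) (cst delta x)%:E <= \int[P]_(x in Bp) (q x)%:E)%E.
    apply: le_integral => //; [exact: icst|exact: iqS|].
    by move=> x; rewrite inE /Bp/= in_itv/= lee_fin andbT => /ltW.
  move: h; rewrite qA// (integral_cst P mBp delta%:E) => h.
  rewrite -[P A]fineK ?fin_num_measure//.
  have {h} : (delta%:E * P Bp <= P A)%E by apply: le_trans h (measureIl _ mA mBp).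
  rewrite -[P A]fineK ?fin_num_measure// -[P Bp]fineK ?fin_num_measure//.
  by rewrite -!EFinM !lee_fin ler_pdivlMl.
have -> : [set x | delta < `|q x|] = Bp `|` Bn.
  apply/seteqP; split=> x; rewrite /Bp /Bn /= !in_itv/= andbT lter_normr ltrNr.
    by move=> /orP[|]; [left|right].
  by move=> [|] ->; rewrite ?orbT.
apply: le_trans (measureU2 _ mBp mBn) _.
by rewrite [X in (_ + X)%E]PBn adde0.
Qed.

End ConditionalMarkov.

(** * Second moments of isotropic rows *)

Section Isotropy.
Context {R : realType} (disp : measure_display) (T : measurableType disp).
Variable P : probability T R.
Context (n : nat) (s : {RV P >-> n.-tuple R}).
Hypothesis s_iso : forall a b,
  (\int[P]_x (tnth (s x) a * tnth (s x) b)%:E = ((a == b)%:R)%:E)%E.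

Let ms a : measurable_fun setT (fun x => tnth (s x) a).
Proof. exact: (measurableT_comp (measurable_tnth a)). Qed.

Let sqr_int a : P.-integrable setT (fun x => (tnth (s x) a ^+ 2)%:E).
Proof.
apply/integrableP; split.
  by apply/measurable_EFinP; exact: measurable_funX.
under eq_integral do rewrite /= ger0_norm ?sqr_ge0// expr2.
by rewrite s_iso ltry.
Qed.

(** Domination by squares, whose integrability is the diagonal part of isotropy. *)
Let mul_int a b : P.-integrable setT (fun x => (tnth (s x) a * tnth (s x) b)%:E).
Proof.
apply: (@le_integrable _ _ _ _ _ measurableT _
  (fun x => (tnth (s x) a ^+ 2)%:E + (tnth (s x) b ^+ 2)%:E)%E).
- by apply/measurable_EFinP; exact: measurable_funM.
- move=> x _; rewrite /= lee_fin normrM [leRHS]ger0_norm ?addr_ge0 ?sqr_ge0//.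
  rewrite -[tnth (s x) a ^+ 2]real_normK ?num_real//.
  rewrite -[tnth (s x) b ^+ 2]real_normK ?num_real//.
  have := sqr_ge0 (`|tnth (s x) a| - `|tnth (s x) b|).
  by have := normr_ge0 (tnth (s x) a); have := normr_ge0 (tnth (s x) b); nra.
- exact: integrableD.
Qed.

Variables (r : R) (p q : 'I_n -> R).
(** Entries of z z^T and of u z both have this shape, with r = 1/n and p, q columns of X or y. *)
Let form (v : n.-tuple R) : R :=
  r * ((\sum_a p a * tnth v a) * (\sum_b q b * tnth v b)).

Let formE x : (form (s x))%:E =
  (\sum_a \sum_b (r * p a * q b)%:E * (tnth (s x) a * tnth (s x) b)%:E)%E.
Proof.
rewrite /form mulr_suml mulr_sumr -sumEFin; apply: eq_bigr => a _.
rewrite !mulr_sumr -sumEFin; apply: eq_bigr => b _.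
by rewrite -EFinM; congr _%:E; ring.
Qed.

Lemma isotropic_form_integrable : P.-integrable setT (fun x => (form (s x))%:E).
Proof.
under eq_fun do rewrite formE.
apply: integrable_sum => // a _; apply: integrable_sum => // b _.
exact: integrableZl.
Qed.

Lemma isotropic_form_mean :
  (\int[P]_x (form (s x))%:E = (r * \sum_a p a * q a)%:E)%E.
Proof.
under eq_integral do rewrite formE.
rewrite integral_sum//; last first.
  by move=> a; apply: integrable_sum => // b _; exact: integrableZl.
rewrite mulr_sumr -sumEFin; apply: eq_bigr => a _.
rewrite integral_sum//; last by move=> b; exact: integrableZl.
rewrite (bigD1 a)//= big1 ?adde0 => [|b ba].
  by rewrite integralZl// s_iso eqxx -EFinM mulr1 mulrA.
by rewrite integralZl// s_iso eq_sym (negbTE ba) mule0.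
Qed.

End Isotropy.

(** * Sketched ridge regression *)

Section Features.
Context {R : realType} (n d : nat) (X : 'M[R]_(n, d)) (y : 'cV[R]_n).
Local Notation feature := ('I_d * 'I_d + 'I_d)%type.

(** One finite index type for the entries of both moments, so that a single scalar argument treats H
    and g together. *)
Definition sketch_feature (e : feature) (v : n.-tuple R) : R :=
  match e with
  | inl kl => (zrow X v *m (zrow X v)^T) kl.1 kl.2
  | inr k => (uentry y v *: zrow X v) k 0
  end.

Definition feature_mean (e : feature) : R :=
  match e with inl kl => gram X kl.1 kl.2 | inr k => cross X y k 0 end.

Lemma measurable_sketch_feature e : measurable_fun setT (sketch_feature e).
Proof.
have mz := measurable_zrow X (@measurable_id _ (n.-tuple R) setT).
have mu := measurable_uentry y (@measurable_id _ (n.-tuple R) setT).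
case: e => [kl|k] /=; last exact: (measurable_mxZ mu mz).
exact: (measurable_mxM mz (measurable_mx_tr mz)).
Qed.

(** Includes n = 0, where both sides are 0 by the convention on inverses. *)
Let sqrtV2 : (Num.sqrt n%:R)^-1 * (Num.sqrt n%:R)^-1 = n%:R^-1 :> R.
Proof. by rewrite -invfM -expr2 sqr_sqrtr. Qed.

Lemma zrowE v k :
  zrow X v k 0 = (Num.sqrt n%:R)^-1 * \sum_a X a k * tnth v a.
Proof.
by rewrite !mxE; congr (_ * _); apply: eq_bigr => a _; rewrite !mxE.
Qed.

Lemma uentryE v : uentry y v = (Num.sqrt n%:R)^-1 * \sum_a y a 0 * tnth v a.
Proof.
by rewrite /uentry mxE; congr (_ * _); apply: eq_bigr => a _; rewrite !mxE.
Qed.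

Lemma sketch_featureE e : exists p q : 'I_n -> R,
  (forall v, sketch_feature e v =
    n%:R^-1 * ((\sum_a p a * tnth v a) * (\sum_b q b * tnth v b))) /\
  feature_mean e = n%:R^-1 * \sum_a p a * q a.
Proof.
case: e => [[k l]|k] /=.
  exists (X ^~ k), (X ^~ l); split.
    by move=> v; rewrite mxE big_ord1 [_^T _ _]mxE !zrowE -sqrtV2; ring.
  by rewrite !mxE; congr (_ * _); apply: eq_bigr => a _; rewrite !mxE.
exists (X ^~ k), (y ^~ 0); split.
  by move=> v; rewrite mxE !zrowE uentryE -sqrtV2; ring.
by rewrite !mxE; congr (_ * _); apply: eq_bigr => a _; rewrite !mxE.
Qed.

(** An entry is at most the norm, and t^2 <= 1 + t^4 follows from (t^2 - 1)^2 >= 0; hence the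
    variance bound 1 + M. *)
Lemma sketch_feature_dev_le e v :
  (sketch_feature e v - feature_mean e) ^+ 2 <=
  1 + (frob_norm (zrow X v *m (zrow X v)^T - gram X) ^+ 4
       + norm2 (uentry y v *: zrow X v - cross X y) ^+ 4).
Proof.
rewrite norm2E.
have sqr4 (t : R) : t ^+ 2 <= 1 + t ^+ 4.
  by have := sqr_ge0 (t ^+ 2 - 1); have := sqr_ge0 t; nra.
have p4 (t : R) : 0 <= t ^+ 4 by rewrite -[4%N]/(2 * 2)%N exprM sqr_ge0.
case: e => [[k l]|k] /=.
  rewrite addrA; apply: (@le_trans _ _ (1 +
      frob_norm (zrow X v *m (zrow X v)^T - gram X) ^+ 4)); last by rewrite lerDl.
  apply: le_trans (sqr4 _); apply: le_trans (sqr_entry_le_frob _ k l).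
  by rewrite [X in _ <= X ^+ 2]mxE [X in _ <= (_ + X) ^+ 2]mxE.
rewrite addrCA; apply: (@le_trans _ _ (1 +
    frob_norm (uentry y v *: zrow X v - cross X y) ^+ 4)); last by rewrite lerDr.
apply: le_trans (sqr4 _); apply: le_trans (sqr_entry_le_frob _ k 0).
by rewrite [X in _ <= X ^+ 2]mxE [X in _ <= (_ + X) ^+ 2]mxE.
Qed.

Lemma boot_dev_sketch m (v : 'I_m -> n.-tuple R) (w : 'I_m -> nat) :
  let z i := zrow X (v i) in
  let u i := uentry y (v i) in
  boot_dev sketch_feature feature_mean v w =
  frob_norm (Hhat z - gram X) ^+ 2 + frob_norm (ghat z u - cross X y) ^+ 2
  + Num.sqrt m%:R * (frob_norm (Hstar z w - Hhat z) ^+ 2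
                     + frob_norm (gstar z u w - ghat z u) ^+ 2).
Proof.
move=> z u.
have col2 (x : 'cV[R]_d) : frob_norm x ^+ 2 = \sum_i x i 0 ^+ 2.
  by rewrite sqr_frob_norm; apply: eq_bigr => i _; rewrite big_ord1.
have HhE k l : (Hhat z - gram X) k l =
    m%:R^-1 * (\sum_i sketch_feature (inl (k, l)) (v i)) - gram X k l.
  by rewrite [LHS]mxE [in LHS]mxE summxE [X in _ + X]mxE.
have ghE k : (ghat z u - cross X y) k 0 =
    m%:R^-1 * (\sum_i sketch_feature (inr k) (v i)) - cross X y k 0.
  by rewrite [LHS]mxE [in LHS]mxE summxE [X in _ + X]mxE.
have HsE k l : (Hstar z w - Hhat z) k l =
    m%:R^-1 * \sum_i ((w i)%:R - 1) * sketch_feature (inl (k, l)) (v i).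
  rewrite /Hstar /Hhat -scalerBr -sumrB mxE summxE; congr (_ * _).
  apply: eq_bigr => i _; rewrite mulrBl mul1r.
  by rewrite [LHS]mxE [X in X + _]mxE [X in _ + X]mxE.
have gsE k : (gstar z u w - ghat z u) k 0 =
    m%:R^-1 * \sum_i ((w i)%:R - 1) * sketch_feature (inr k) (v i).
  rewrite /gstar /ghat -scalerBr -sumrB mxE summxE; congr (_ * _).
  apply: eq_bigr => i _; rewrite mulrBl mul1r.
  by rewrite [LHS]mxE [X in X + _]mxE [X in _ + X]mxE.
rewrite /boot_dev big_split/= !big_sumType/= -!mulr_sumr -mulrDr.
rewrite !col2 !sqr_frob_norm !pair_bigA/=.
congr (_ + _ + _ * (_ + _)).
- by apply: eq_bigr => -[k l] _; rewrite HhE.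
- by apply: eq_bigr => k _; rewrite ghE.
- by apply: eq_bigr => -[k l] _; rewrite HsE.
- by apply: eq_bigr => k _; rewrite gsE.
Qed.

End Features.

Section RefitError.
Context {R : realType} (d : nat).

(** The three terms of [eta] serve in turn |g^ - g| <= 1, the two margins c/4, and the final error;
    K is the constant of [ridge_refit_bound] once its right-hand side is bounded by squares. *)
Lemma refit_error_small (n m : nat) (X : 'M[R]_(n, d)) (y : 'cV[R]_n)
    (v : 'I_m -> n.-tuple R) (w : 'I_m -> nat) (lam c G eps : R) :
  let K := (2 / c) ^+ 2 * (1 + 2 / c * (G + 1)) in
  let eta := Num.min 1 (Num.min ((c / 4) ^+ 2) (eps / K)) in
  let z i := zrow X (v i) in
  let u i := uentry y (v i) in
  (0 < m)%N -> 0 < c -> 0 <= G -> 0 <= lam ->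
  c <= lambda_min (gram X + lam%:M) -> frob_norm (cross X y) <= G ->
  boot_dev (sketch_feature X y) (feature_mean X y) v w < eta ->
  Num.sqrt m%:R * norm2 ((betastar z u lam w - betahat z u lam)
                         - lin_change z u lam w) <= eps.
Proof.
move=> K eta z u m0 c0 G0 lam0 cmin gG.
rewrite boot_dev_sketch -/z -/u norm2E !lt_min => /and3P[dev1 devc devK].
have sqrtm1 : 1 <= Num.sqrt m%:R :> R by rewrite -[leLHS]sqrtr1 ler_sqrt// ler1n.
have K0 : 0 < K.
  rewrite mulr_gt0 ?exprn_gt0 ?divr_gt0// ltr_wpDr// mulr_ge0 ?addr_ge0//.
  by rewrite divr_ge0// ltW.
move: dev1 devc devK.
set a := frob_norm (Hhat z - gram X); set e := frob_norm (ghat z u - cross X y).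
set h := frob_norm (Hstar z w - Hhat z).
set k := frob_norm (gstar z u w - ghat z u).
have [a0 e0 h0 k0] : [/\ 0 <= a, 0 <= e, 0 <= h & 0 <= k].
  by split; exact: frob_norm_ge0.
rewrite ltr_pdivlMr// => dev1 devc devK.
have hk0 : 0 <= h ^+ 2 + k ^+ 2 by rewrite addr_ge0 ?sqr_ge0.
(* As sqrt m >= 1, the weighted part also controls the unweighted square that the margin c/4
   needs. *)
have hk1 : h ^+ 2 <= Num.sqrt m%:R * (h ^+ 2 + k ^+ 2).
  apply: (@le_trans _ _ (1 * (h ^+ 2 + k ^+ 2))).
    by rewrite mul1r lerDl sqr_ge0.
  by rewrite ler_wpM2r.
have c4 : 0 <= c / 4 by rewrite divr_ge0// ltW.
have ac : a <= c / 4.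
  rewrite -(@ler_pXn2r _ 2)//; have := sqr_ge0 e; have := sqr_ge0 h.
  by move: hk1 devc; lra.
have hc : h <= c / 4.
  rewrite -(@ler_pXn2r _ 2)//; have := sqr_ge0 e; have := sqr_ge0 a.
  by move: hk1 devc; lra.
have e1 : e <= 1.
  rewrite -(@expr_le1 _ 2)//; have := sqr_ge0 h; have := sqr_ge0 a.
  by move: hk1 dev1; lra.
have coerc : coercive (gram X + lam%:M) c.
  apply: lambda_min_coercive cmin.
    rewrite [LHS]raddfD/= tr_scalar_mx; congr (_ + _).
    by rewrite /gram linearZ/= trmx_mul trmxK.
  apply: coerciveW (coercive_scalar_add lam (gram_coercive X)).
  by rewrite add0r.
have := ridge_refit_bound (gstar z u w) c0 coerc ac hc gG e1.
rewrite -/h -/k => bound.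
apply: (@le_trans _ _ (Num.sqrt m%:R * ((2 / c) ^+ 2 * h
    * (k + h * (2 / c * (G + 1)))))).
  by rewrite ler_wpM2l.
have B0 : 0 <= 2 / c * (G + 1) by rewrite mulr_ge0 ?addr_ge0// divr_ge0// ltW.
have hkB : h * (k + h * (2 / c * (G + 1))) <=
    (1 + 2 / c * (G + 1)) * (h ^+ 2 + k ^+ 2).
  move: (2 / c * (G + 1)) B0 => B B0.
  have := sqr_ge0 (h - k); have := mulr_ge0 B0 (sqr_ge0 k); nra.
apply: (@le_trans _ _ (K * (Num.sqrt m%:R * (h ^+ 2 + k ^+ 2)))); last first.
  by apply: le_trans (ltW devK); rewrite mulrC ler_pM2r// lerDr addr_ge0 ?sqr_ge0.
rewrite -mulrA mulrCA /K -[leRHS]mulrA; apply: ler_wpM2l; first exact: sqr_ge0.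
by rewrite [leRHS]mulrCA; apply: ler_wpM2l.
Qed.

End RefitError.

(** [eta] depends on c, G and eps alone, which makes the bound uniform along the array; the cardinal
    counts the features. *)
Lemma refit_error_prob_le (R : realType) (n d m : nat) (X : 'M[R]_(n, d))
    (y : 'cV[R]_n) (lam c G eps M : R) (disp : measure_display)
    (T : measurableType disp) (P : probability T R)
    (s : 'I_m -> {RV P >-> n.-tuple R}) (w : nat -> 'I_m -> {RV P >-> nat})
    (i0 : 'I_m) (b : nat) :
  let K := (2 / c) ^+ 2 * (1 + 2 / c * (G + 1)) in
  let eta := Num.min 1 (Num.min ((c / 4) ^+ 2) (eps / K)) in
  0 < c -> 0 <= G -> 0 < lam -> 0 < eps ->
  c <= lambda_min (gram X + lam%:M) -> frob_norm (cross X y) <= G ->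
  mutually_independent s -> identically_distributed s ->
  expect_mx P (fun x => let v := col_of_tuple (s i0 x) in v *m v^T)
    = map_mx EFin 1%:M ->
  ('E_P[fun x =>
      let z1 := zrow X (s i0 x) in
      let u1 := uentry y (s i0 x) in
      (frob_norm (z1 *m z1^T - gram X) ^+ 4
       + norm2 (u1 *: z1 - cross X y) ^+ 4)%R] <= M%:E)%E ->
  multinomial_weights (g_sigma_preimage s) w ->
  (P [set x |
      let z := fun i => zrow X (s i x) in
      let u := fun i => uentry y (s i x) in
      let wb := fun i => w b i x in
      (eps < Num.sqrt m%:R *
        norm2 ((betastar z u lam wb - betahat z u lam)
               - lin_change z u lam wb))%R] <=
   (eta^-1 * (#|{: 'I_d * 'I_d + 'I_d}|%:R
     * ((1 + Num.sqrt m%:R) * ((1 + M) / m%:R))))%:E)%E.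
Proof.
move=> K eta c0 G0 lam0 eps0 cmin gG s_indep s_ident s_iso s_mom w_mult.
have m0 : (0 < m)%N by exact: leq_ltn_trans (ltn_ord i0).
have K0 : 0 < K.
  rewrite mulr_gt0 ?exprn_gt0 ?divr_gt0// ltr_wpDr// mulr_ge0 ?addr_ge0//.
  by rewrite divr_ge0// ltW.
have eta0 : 0 < eta by rewrite !lt_min ltr01 exprn_gt0 ?divr_gt0.
have iso a a' : (\int[P]_x (tnth (s i0 x) a * tnth (s i0 x) a')%:E
    = ((a == a')%:R)%:E)%E.
  have := congr1 (fun N : 'M[\bar R]_n => N a a') s_iso.
  rewrite !mxE unlock => <-; apply: eq_integral => x _.
  by rewrite mxE big_ord1 !mxE.
have ms i : measurable_fun setT (s i : T -> n.-tuple R) by [].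
have mfeat e := measurable_sketch_feature X y e.
apply: (bootstrap_prob_le mfeat (c := feature_mean X y) s_indep s_ident w_mult
  (i0 := i0) _ _ _ (b := b)) => //.
- move=> e; have [p [q [fE _]]] := sketch_featureE X y e.
  rewrite (_ : _ \o _ = fun x => (n%:R^-1 * ((\sum_a p a * tnth (s i0 x) a) *
    (\sum_b q b * tnth (s i0 x) b)))%:E).
    exact: isotropic_form_integrable.
  by apply/funext => x /=; rewrite fE.
- move=> e; have [p [q [fE ->]]] := sketch_featureE X y e.
  by under eq_integral do rewrite fE; exact: isotropic_form_mean.
- move=> e; pose F x := frob_norm (zrow X (s i0 x) *m (zrow X (s i0 x))^T - gram X) ^+ 4
    + norm2 (uentry y (s i0 x) *: zrow X (s i0 x) - cross X y) ^+ 4.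
  have F0 x : 0 <= F x by rewrite addr_ge0// exprn_ge0// sqrtr_ge0.
  have mF : measurable_fun setT F.
    apply: measurable_funD; apply: measurable_funX.
      apply: measurable_frob_norm; apply: measurable_mxB.
        by apply: measurable_mxM; last apply: measurable_mx_tr;
          exact: measurable_zrow.
      exact: measurable_mx_cst.
    under eq_fun do rewrite norm2E.
    apply: measurable_frob_norm; apply: measurable_mxB.
      by apply: measurable_mxZ; [exact: measurable_uentry|exact: measurable_zrow].
    exact: measurable_mx_cst.
  apply: (@le_trans _ _ (\int[P]_x ((1 : R)%:E + (F x)%:E))%E).
    apply: ge0_le_integral => //.
    + by move=> x _; rewrite lee_fin sqr_ge0.
    + apply/measurable_EFinP; apply: measurable_funX; apply: measurable_funB => //.
      exact: measurableT_comp.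
    + by apply/measurable_EFinP; exact: measurable_funD.
    + by move=> x _; rewrite -EFinD lee_fin; exact: sketch_feature_dev_le.
  rewrite ge0_integralD//; last 2 first.
  + by move=> x _; rewrite lee_fin.
  + exact/measurable_EFinP.
  rewrite EFinD; apply: leeD; last by move: s_mom; rewrite unlock.
  by rewrite (integral_cst P measurableT 1%E) mul1e probability_le1.
- apply: (@measurable_refit_error _ _ _ lam eps (Num.sqrt m%:R) _ _
    (fun i x => zrow X (s i x)) (fun i x => uentry y (s i x))
    (fun i x => w b i x)) => // i; first exact: measurable_zrow.
  exact: measurable_uentry.
(* Contrapositive of the deterministic bound: a statistic below [eta] forces an error of at most
   eps. *)
- move=> x /=; rewrite ltNge; apply: contraNle.
  by apply: refit_error_small => //; exact: ltW.
Qed.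

(** * Limits along the array *)

Lemma cvg_frob_norm_bounded (R : realType) p q (M : nat -> 'M[R]_(p, q))
    (L : 'M[R]_(p, q)) : M @ \oo --> L ->
  exists2 G, 0 <= G & \forall n \near \oo, frob_norm (M n) <= G.
Proof.
(* Convergence is entrywise: eventually M n - L has entries below 1 in absolute value, so the
   all-ones matrix dominates it in norm. *)
move=> ML; exists (frob_norm L + frob_norm (const_mx 1 : 'M[R]_(p, q))).
  by rewrite addr_ge0 ?frob_norm_ge0.
have Lnbhs : nbhs L [set N : 'M[R]_(p, q) | forall i j, `|L i j - N i j| < 1].
  exists (fun i j => ball (L i j) 1); last by move=> N.
  by move=> i j; exact: nbhsx_ballx.
have MLn : \forall n \near \oo, forall i j, `|L i j - M n i j| < 1 by exact: (ML _ Lnbhs).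
near=> n; have H : forall i j, `|L i j - M n i j| < 1 by near: n.
rewrite -(subrK L (M n)) addrC; apply: le_trans (frob_normD _ _) _.
rewrite lerD2l frob_norm_leP ?frob_norm_ge0// sqr_frob_norm.
apply: ler_sum => i _; apply: ler_sum => j _.
rewrite !mxE expr1n -[_ ^+ 2]real_normK ?num_real// expr_le1//.
by rewrite distrC ltW.
Unshelve. all: by end_near. Qed.

Lemma cvg_inv_sqrt_nat (R : realType) (m : nat -> nat) :
  (forall n, (0 < m n)%N) -> m @ \oo --> \oo ->
  (Num.sqrt (m n)%:R)^-1 @[n --> \oo] --> (0 : R).
Proof.
move=> m0 moo; apply/gtr0_cvgV0.
  by near=> n; rewrite sqrtr_gt0 ltr0n.
apply/cvgryPge => A.
have near_m : \forall n \near \oo, ((Num.truncn (A ^+ 2)).+1 <= m n)%N.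
  exact: (moo _ (nbhs_infty_ge _)).
near=> n; apply: le_trans (ler_norm A) _; rewrite -sqrtr_sqr ler_wsqrtr//.
apply: le_trans (ltW (Num.Theory.truncnS_gt _)) _; rewrite ler_nat.
by near: n.
Unshelve. all: by end_near. Qed.

Theorem proposition2 (R : realType) (d : nat) (hd : (0 < d)%N)
  (m : nat -> nat) (m_gt0 : forall n, (0 < m n)%N) (m_oo : m @ \oo --> \oo)
  (X : forall n, 'M[R]_(n, d)) (y : forall n, 'cV[R]_n) (lam : nat -> R)
  (lam_gt0 : forall n, 0 < lam n)
  (disp : nat -> measure_display) (T : forall n, measurableType (disp n))
  (P : forall n, probability (T n) R)
  (s : forall n, 'I_(m n) -> {RV (P n) >-> n.-tuple R})
  (w : forall n, nat -> 'I_(m n) -> {RV (P n) >-> nat})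
  (* (i) *)
  (lam_oo : R) (lam_oo_ge0 : 0 <= lam_oo) (cvg_lam : lam @ \oo --> lam_oo)
  (H : 'M[R]_d) (cvg_H : (fun n => gram (X n)) @ \oo --> H)
  (g : 'cV[R]_d) (cvg_g : (fun n => cross (X n) (y n)) @ \oo --> g)
  (c0 : R) (c0_gt0 : 0 < c0)
  (eig_ge : \forall n \near \oo, c0 <= lambda_min (gram (X n) + (lam n)%:M))
  (* (ii) *)
  (s_indep : forall n, mutually_independent (s n))
  (s_ident : forall n, identically_distributed (s n))
  (s_isotropic : forall n,
     expect_mx (P n) (fun x => let v := col_of_tuple (s n (Ordinal (m_gt0 n)) x)
                               in v *m v^T)
     = map_mx EFin 1%:M)
  (s_moments : (ereal_sup (range (fun n =>
     'E_(P n)[fun x =>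
        let s1 := s n (Ordinal (m_gt0 n)) x in
        let z1 := zrow (X n) s1 in
        let u1 := uentry (y n) s1 in
        (frob_norm (z1 *m z1^T - gram (X n)) ^+ 4
         + norm2 (u1 *: z1 - cross (X n) (y n)) ^+ 4)%R])) < +oo)%E)
  (Omega : 'M[R]_d)
  (cvg_Omega : (fun n =>
     expect_mx (P n) (fun x =>
       let psi := influence (X n) (y n) (lam n) (s n (Ordinal (m_gt0 n)) x)
       in psi *m psi^T)) @ \oo --> map_mx EFin Omega)
  (* conditionally on the sketch, independent multinomial weight vectors *)
  (w_multinomial : forall n,
     multinomial_weights (g_sigma_preimage (s n)) (w n)) :
  forall (b : nat) (eps : R), 0 < eps ->
    cond_prob_cvg0 P (fun n => g_sigma_preimage (s n))
      (fun n => [set x |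
         let z := fun i => zrow (X n) (s n i x) in
         let u := fun i => uentry (y n) (s n i x) in
         let wb := fun i => w n b i x in
         eps < Num.sqrt (m n)%:R *
               norm2 ((betastar z u (lam n) wb - betahat z u (lam n))
                      - lin_change z u (lam n) wb)]).
Proof.
have [M M0 EM] : exists2 M, 0 <= M & forall n, ('E_(P n)[fun x =>
        let s1 := s n (Ordinal (m_gt0 n)) x in
        let z1 := zrow (X n) s1 in
        let u1 := uentry (y n) s1 in
        (frob_norm (z1 *m z1^T - gram (X n)) ^+ 4
         + norm2 (u1 *: z1 - cross (X n) (y n)) ^+ 4)%R] <= M%:E)%E.
  move: s_moments; set S := ereal_sup _ => Soo.
  have le_S n := @ereal_sup_ubound _ _ _ (imageP _ (I : [set: nat] n)) : (_ <= S)%E.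
  (* One index suffices for S >= 0; with S < +oo, [fine S] is then a genuine real bound for every
     n. *)
  have S0 : (0 <= S)%E.
    apply: le_trans (le_S 0%N); apply: expectation_ge0 => x.
    by rewrite addr_ge0// exprn_ge0// sqrtr_ge0.
  exists (fine S); first exact: fine_ge0.
  by move=> n; rewrite fineK ?ge0_fin_numE//; exact: le_S.
have [G G0 gG] := cvg_frob_norm_bounded cvg_g.
move=> b eps eps0; set A := (X in cond_prob_cvg0 _ _ X).
move=> q q_cond delta delta0.
(* None of [K], [eta], [N], [C] depends on n, so C / sqrt m_n bounds the probability for all large
   n. *)
pose K := (2 / c0) ^+ 2 * (1 + 2 / c0 * (G + 1)).
pose eta := Num.min 1 (Num.min ((c0 / 4) ^+ 2) (eps / K)).
pose N : R := #|{: 'I_d * 'I_d + 'I_d}|%:R.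
pose C := delta^-1 * (eta^-1 * (N * (2 * (1 + M)))).
have K0 : 0 < K.
  rewrite mulr_gt0 ?exprn_gt0 ?divr_gt0// ltr_wpDr// mulr_ge0 ?addr_ge0//.
  by rewrite divr_ge0// ltW.
have eta0 : 0 < eta by rewrite !lt_min ltr01 exprn_gt0 ?divr_gt0.
have mA n : measurable (A n).
  apply: (@measurable_refit_error _ _ _ (lam n) eps (Num.sqrt (m n)%:R) _ _
    (fun i x => zrow (X n) (s n i x)) (fun i x => uentry (y n) (s n i x))
    (fun i x => w n b i x)) => // i; first exact: measurable_zrow.
  exact: measurable_uentry.
have Gm n : g_sigma_preimage (s n) `<=` measurable.
  apply: smallest_sub; first exact: sigma_algebra_measurable.
  rewrite -bigcup_seq; apply: bigcup_sub => i _ _ [B mB <-].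
  by rewrite setTI; exact: measurable_funPTI.
apply: (@squeeze_cvge _ _ _ _ (cst 0%E) _
    (fun n => (C * (Num.sqrt (m n)%:R)^-1)%:E)).
- near=> n; rewrite measure_ge0/=.
  apply: le_trans (cond_prob_markov (Gm n) (mA n) (q_cond n) delta0) _.
  have gGn : frob_norm (cross (X n) (y n)) <= G by near: n.
  have cn : c0 <= lambda_min (gram (X n) + (lam n)%:M) by near: n.
  have := refit_error_prob_le b c0_gt0 G0 (lam_gt0 n) eps0 cn gGn
    (s_indep n) (s_ident n) (s_isotropic n) (EM n) (w_multinomial n).
  rewrite -/K -/eta -/(A n) => PA.
  apply: le_trans (lee_wpmul2l _ PA) _; first by rewrite lee_fin invr_ge0 ltW.
  rewrite -EFinM lee_fin.
  rewrite (_ : C * _ = delta^-1 * (eta^-1 * (N * (2 * (1 + M)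
      * (Num.sqrt (m n)%:R)^-1)))); last by rewrite /C !mulrA.
  do 2![apply: ler_wpM2l; first by rewrite invr_ge0 ltW].
  apply: ler_wpM2l => //.
  have mR : 0 < (m n)%:R :> R by rewrite ltr0n.
  have sm0 : 0 < Num.sqrt (m n)%:R :> R by rewrite sqrtr_gt0.
  have sm1 : 1 <= Num.sqrt (m n)%:R :> R.
    by rewrite -[leLHS]sqrtr1 ler_sqrt// ler1n.
  (* With r = sqrt m >= 1, (1 + r) / r^2 <= 2 / r: the origin of the 2 in [C]. *)
  rewrite -[X in (1 + M) / X](sqr_sqrtr (ltW mR)).
  move: (Num.sqrt _) sm0 sm1 => r r0 r1.
  rewrite ler_pdivlMr// (_ : _ * r = (1 + r) * (1 + M) / r); last first.
    by field; rewrite gt_eqF.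
  rewrite ler_pdivrMr// [leRHS]mulrAC ler_wpM2r ?addr_ge0//.
  by lra.
- exact: cvg_cst.
- apply: cvg_EFin; first by near=> n.
  rewrite -(mulr0 C); apply: cvgM; first exact: cvg_cst.
  exact: cvg_inv_sqrt_nat.
Unshelve. all: by end_near. Qed.
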